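(* Let $(R,m)$ be a noetherian local ring that is complete (in the $m$-adic topology) and let $I$ be a proper ideal of $R$ such that $H^l_I(R)=0$ for every $l>h:=\operatorname{height}(I)\geq 1$. Let $\underline{x}=x_1,\dots,x_h\in I$ be an $R$-regular sequence (this implies $H^l_I(R)=0$ for every $l\neq h$). Set $D:=D(H^h_I(R))$, the Matlis dual of $H^h_I(R)$. The following statements are equivalent: (i) $\sqrt{I}=\sqrt{\underline{x}R}$; in particular, $I$ is a set-theoretic complete intersection. (ii) $\underline{x}$ is a $D$-regular sequence. (iii) The canonical map $\iota_{D,\underline{x}}:D/\underline{x}D\to H^h_{\underline{x}R}(D)$ is injective. (iv) The canonical map $j_{\underline{x},I}:J_{\underline{x},I}\to \Gamma_I(R/\underline{x}R)$ is surjective. (v) $J_{\underline{x},I}=R$.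
   Context: Rings are commutative and unitary. $H^n_I$ denotes the $n$-th local cohomology functor with support in $I$, and $\Gamma_I=H^0_I$. The Matlis dual of an $R$-module $M$ is $D(M)=\operatorname{Hom}_R(M,E)$, where $E=E_R(R/m)$ is a fixed $R$-injective hull of $R/m$. Write $\underline{x}R=(x_1,\dots,x_h)R$ and $\underline{x}^l=x_1^l,\dots,x_h^l$. A sequence $\underline{x}$ is $M$-regular (for an arbitrary $R$-module $M$) if multiplication by $x_i$ on $M/(x_1,\dots,x_{i-1})M$ is injective for $i=1,\dots,h$ and $M/\underline{x}M\neq 0$. For an $R$-module $M$, $\iota_{M,\underline{x}}:M/\underline{x}M\to H^h_{\underline{x}R}(M)$ is the canonical map coming from the description $H^h_{\underline{x}R}(M)=\varinjlim_{l}M/(x_1^l,\dots,x_h^l)M$, with transition maps induced by multiplication by $x_1\cdots x_h$ (the map from the $l=1$ term to the direct limit). The ideal $J_{\underline{x},I}$ of $R$ is defined as $D(H^h_{\underline{x}R}(D(H^h_I(R))))$, regarded as an ideal of $R$ via the monomorphism $D(H^h_{\underline{x}R}(D(H^h_I(R))))\hookrightarrow D(H^h_{\underline{x}R}(D(H^h_{\underline{x}R}(R))))\cong R$ induced by the inclusion $H^h_I(R)=\Gamma_I(H^h_{\underline{x}R}(R))\subseteq H^h_{\underline{x}R}(R)$; concretely, $$J_{\underline{x},I}=\{r\in R\mid \text{for every } l\in\mathbb{N} \text{ there exists } s\in\mathbb{N} \text{ with } r\cdot I^s\subseteq \underline{x}^lR\}.$$ The map $j_{\underline{x},I}:J_{\underline{x},I}\to\Gamma_I(R/\underline{x}R)$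 is the restriction of the canonical map $R\to R/\underline{x}R$ to $J_{\underline{x},I}$ (its image lies in $\Gamma_I(R/\underline{x}R)$). *)

(* Defs.v *)
From HB Require Import structures.
From mathcomp Require Import all_boot all_algebra.
From mathcomp Require Import ring_quotient generic_quotient.
From mathcomp Require Import boolp classical_sets functions.

Set Implicit Arguments.
Unset Strict Implicit.
Unset Printing Implicit Defensive.

Import GRing.Theory.

Local Open Scope ring_scope.
Local Open Scope quotient_scope.

(* Submodules are MathComp's [submodClosed V]; ideals of R are submodules of
   R^o. The library derives closure under opposite only for a fixed predicate,
   not for a variable of type [submodClosed V], hence the wrapper [mem_sub]. *)
Section SubQuot.
Variables (R : pzRingType) (V : lmodType R) (S : submodClosed V).

Definition mem_sub : {pred V} := fun u => u \in S.
HB.instance Definition _ :=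
  GRing.isSubmodClosed.Build R V mem_sub (submodClosedP S).

Definition submod := {u : V | u \in mem_sub}.
HB.instance Definition _ := SubChoice.on submod.
HB.instance Definition _ := [SubChoice_isSubLmodule of submod by <:].

Definition quotmod := @ring_quotient.Quotient.quot V mem_sub.
HB.instance Definition _ := GRing.Zmodule.on quotmod.
HB.instance Definition _ := EqQuotient.on quotmod.

Definition quot_scale (a : R) (u : quotmod) : quotmod :=
  \pi_quotmod (a *: repr u).

Lemma quot_scale_pi a (u : V) :
  quot_scale a (\pi_quotmod u) = \pi_quotmod (a *: u).
Proof.
apply/eqP; rewrite -(@ring_quotient.Quotient.idealrBE V mem_sub) -scalerBr.
rewrite rpredZ //.
by rewrite (@ring_quotient.Quotient.idealrBE V mem_sub) reprK.
Qed.

Lemma quot_addE (u v : V) :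
  \pi_quotmod (u + v) = \pi_quotmod u + \pi_quotmod v :> quotmod.
Proof. exact: (@ring_quotient.Quotient.pi_add V mem_sub). Qed.

Lemma quot_scaleA a b (u : quotmod) :
  quot_scale a (quot_scale b u) = quot_scale (a * b) u.
Proof.
elim/quotW: u => u.
by rewrite [quot_scale b _]quot_scale_pi !quot_scale_pi scalerA.
Qed.

Lemma quot_scale1 : left_id 1 quot_scale.
Proof. by elim/quotW=> u; rewrite quot_scale_pi scale1r. Qed.

Lemma quot_scaleDr : right_distributive quot_scale +%R.
Proof.
move=> a; elim/quotW=> u; elim/quotW=> v.
by rewrite -quot_addE !quot_scale_pi scalerDr quot_addE.
Qed.

Lemma quot_scaleDl (u : quotmod) : {morph quot_scale^~ u : a b / a + b}.
Proof.
by move=> a b; elim/quotW: u => u; rewrite !quot_scale_pi scalerDl quot_addE.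
Qed.

HB.instance Definition _ := GRing.Zmodule_isLmodule.Build R quotmod
  quot_scaleA quot_scale1 quot_scaleDr quot_scaleDl.

Definition quot_pr (u : V) : quotmod := \pi_quotmod u.

Lemma quot_pr_is_linear : linear quot_pr.
Proof. by move=> a u v; rewrite /quot_pr quot_addE -quot_scale_pi. Qed.

HB.instance Definition _ :=
  GRing.isLinear.Build R V quotmod _ quot_pr quot_pr_is_linear.

Lemma quot_pr_eq0 u : (quot_pr u == 0) = (u \in S).
Proof.
rewrite -(raddf0 quot_pr) -(@ring_quotient.Quotient.idealrBE V mem_sub).
by rewrite subr0.
Qed.

Lemma quot_pr_surj (z : quotmod) : exists u, z = quot_pr u.
Proof. by exists (repr z); rewrite /quot_pr reprK. Qed.

End SubQuot.

Section Hom.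
Variables (R : comNzRingType) (U V : lmodType R).

Definition Hom := {linear U -> V}.
HB.instance Definition _ := gen_eqMixin Hom.
HB.instance Definition _ := gen_choiceMixin Hom.

Implicit Types f g : Hom.

Lemma Hom_ext f g : (f : U -> V) =1 g -> f = g.
Proof.
case: f g => [f cf] [g cg] /= /funext E; subst g.
case: cf cg => [[f1] [f2]] [[g1] [g2]].
by rewrite (Prop_irrelevance f1 g1) (Prop_irrelevance f2 g2).
Qed.

Definition Hom_zero : Hom := (\0 : {linear U -> V}).
Definition Hom_add f g : Hom := (f \+ g : {linear U -> V}).
Definition Hom_opp f : Hom := (\- f : {linear U -> V}).
Definition Hom_scale (a : R) f : Hom := (a \*: f : {linear U -> V}).

Lemma Hom_addA : associative Hom_add.
Proof. by move=> f g k; apply: Hom_ext => u /=; rewrite addrA. Qed.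
Lemma Hom_addC : commutative Hom_add.
Proof. by move=> f g; apply: Hom_ext => u /=; rewrite addrC. Qed.
Lemma Hom_add0 : left_id Hom_zero Hom_add.
Proof. by move=> f; apply: Hom_ext => u /=; rewrite add0r. Qed.
Lemma Hom_addN : left_inverse Hom_zero Hom_opp Hom_add.
Proof. by move=> f; apply: Hom_ext => u /=; rewrite addNr. Qed.

HB.instance Definition _ :=
  GRing.isZmodule.Build Hom Hom_addA Hom_addC Hom_add0 Hom_addN.

Lemma Hom_scaleA a b f : Hom_scale a (Hom_scale b f) = Hom_scale (a * b) f.
Proof. by apply: Hom_ext => u /=; rewrite scalerA. Qed.
Lemma Hom_scale1 : left_id 1 Hom_scale.
Proof. by move=> f; apply: Hom_ext => u /=; rewrite scale1r. Qed.
Lemma Hom_scaleDr : right_distributive Hom_scale +%R.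
Proof. by move=> a f g; apply: Hom_ext => u /=; rewrite scalerDr. Qed.
Lemma Hom_scaleDl f : {morph Hom_scale^~ f : a b / a + b}.
Proof. by move=> a b; apply: Hom_ext => u /=; rewrite scalerDl. Qed.

HB.instance Definition _ := GRing.Zmodule_isLmodule.Build R Hom
  Hom_scaleA Hom_scale1 Hom_scaleDr Hom_scaleDl.

End Hom.

(* D(M) = Hom_R(M, E), for E an injective hull of the residue field. *)
Definition matlis_dual (R : comNzRingType) (E M : lmodType R) : lmodType R :=
  Hom M E.

Section GeneratedSubmodule.
Variables (R : comNzRingType) (M : lmodType R).

(* (y_1, ..., y_k) M *)
Definition gen k (y : 'I_k -> R) : {pred M} :=
  fun u => `[< exists v : 'I_k -> M, u = \sum_(i < k) y i *: v i >].

Lemma gen_closed k (y : 'I_k -> R) : submod_closed (gen y).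
Proof.
split=> [|a u v /asboolP[u' ->] /asboolP[v' ->]]; apply/asboolP.
  by exists (fun=> 0); rewrite big1 // => i _; rewrite scaler0.
exists (fun i => a *: u' i + v' i); rewrite scaler_sumr -big_split /=.
by apply: eq_bigr => i _; rewrite scalerDr !scalerA [a * _]mulrC.
Qed.
HB.instance Definition _ k (y : 'I_k -> R) :=
  GRing.isSubmodClosed.Build R M (gen y) (gen_closed y).

End GeneratedSubmodule.
Arguments gen {R} M {k} y.

Section Ideals.
Variable R : comNzRingType.

Definition ideal := submodClosed R^o.
Implicit Types I J P m : ideal.

Definition proper_idl I := (1 : R) \notin I.

Definition prime_ideal P := proper_idl P /\ @prime_idealr_closed R P.

Definition maximal_ideal m :=
  proper_idl m /\
  forall J, proper_idl J -> {subset m <= J} -> J =i m.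

Definition local_ring m :=
  maximal_ideal m /\ forall n, maximal_ideal n -> n =i m.

Definition noetherian :=
  forall J, exists k (y : 'I_k -> R), J =i gen R^o y.

(* [ideal_pow I 0] is the unit ideal. *)
Definition ideal_pow I s : {pred R} := fun a =>
  `[< exists n (c : 'I_n -> R) (b : 'I_n -> 'I_s -> R),
      (forall i j, b i j \in I) /\
      a = \sum_(i < n) c i * \prod_(j < s) b i j >].

Lemma ideal_powS I s a : a \in ideal_pow I s.+1 -> a \in ideal_pow I s.
Proof.
move=> /asboolP[n [c [b [bI ->]]]]; apply/asboolP.
exists n, (fun i => c i * b i ord_max).
exists (fun i j => b i (widen_ord (leqnSn s) j)); split=> // .
by apply: eq_bigr => i _; rewrite big_ord_recr /= -mulrA [_ * b i _]mulrC.
Qed.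

Lemma ideal_pow_le I s t a :
  (s <= t)%N -> a \in ideal_pow I t -> a \in ideal_pow I s.
Proof.
move=> /subnK <-; elim: (t - s)%N => // n IHn; rewrite addSn => /ideal_powS.
exact: IHn.
Qed.

Definition adic_complete m :=
  (forall a, (forall n, a \in ideal_pow m n) -> a = 0) /\
  forall u : nat -> R,
    (forall n, exists N, forall p q, (N <= p)%N -> (N <= q)%N ->
       u p - u q \in ideal_pow m n) ->
    exists a, forall n, exists N, forall p, (N <= p)%N ->
      u p - a \in ideal_pow m n.

Definition radical (A : {pred R}) : {pred R} :=
  fun r => `[< exists n, r ^+ n \in A >].

(* There is a chain p_0 < ... < p_n = P of prime ideals. *)
Definition prime_chain P n :=
  exists p : nat -> ideal,
    [/\ forall i, (i <= n)%N -> prime_ideal (p i),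
        forall i, (i < n)%N -> {subset p i <= p i.+1} /\ ~ (p i =i p i.+1)
      & p n =i P].

Definition prime_height P n :=
  prime_chain P n /\ forall k, prime_chain P k -> (k <= n)%N.

Definition height I n :=
  (exists P, [/\ prime_ideal P, {subset I <= P} & prime_height P n]) /\
  forall P k, prime_ideal P -> {subset I <= P} -> prime_height P k ->
    (n <= k)%N.

Definition set_theoretic_ci I :=
  exists h (y : 'I_h -> R), height I h /\ radical I =i radical (gen R^o y).

End Ideals.

Section Modules.
Variable R : comNzRingType.

Definition prefix_seq h (x : 'I_h -> R) (i : 'I_h) (j : 'I_i) : R :=
  x (widen_ord (ltnW (ltn_ord i)) j).

Definition regular_seq h (x : 'I_h -> R) (M : lmodType R) :=
  (forall i : 'I_h,
     injective (fun u : quotmod (gen M (@prefix_seq h x i)) => x i *: u)) /\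
  exists u : quotmod (gen M x), u != 0.

Definition injective_module (E : lmodType R) :=
  forall (A B : lmodType R) (i : {linear A -> B}) (f : {linear A -> E}),
    injective i -> exists g : {linear B -> E}, forall a, g (i a) = f a.

Definition injective_hull (M E : lmodType R) (i : {linear M -> E}) :=
  [/\ injective i, injective_module E
    & forall N : submodClosed E, (exists2 e, e \in N & e != 0) ->
        exists2 u, i u \in N & i u != 0].

Section Gamma.
Variables (I : ideal R) (M : lmodType R).

Definition Gamma : {pred M} := fun u =>
  `[< exists s, forall a, a \in ideal_pow I s -> a *: u = 0 >].

Lemma Gamma_closed : submod_closed Gamma.
Proof.
split=> [|a u v /asboolP[s us] /asboolP[t vt]]; apply/asboolP.
  by exists 0 => a _; rewrite scaler0.
exists (maxn s t) => b bI; rewrite scalerDr scalerA mulrC -scalerA.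
rewrite us ?(ideal_pow_le _ bI) ?leq_maxl //.
rewrite vt ?(ideal_pow_le _ bI) ?leq_maxr //; by rewrite scaler0 addr0.
Qed.
HB.instance Definition _ := GRing.isSubmodClosed.Build R M Gamma Gamma_closed.
End Gamma.
Arguments Gamma I M : clear implicits.

Record injective_resolution (M : lmodType R) := InjectiveResolution {
  res_obj :> nat -> lmodType R;
  res_diff : forall n, {linear res_obj n -> res_obj n.+1};
  res_aug : {linear M -> res_obj 0};
  res_aug_inj : injective res_aug;
  res_exact0 : forall c, res_diff 0 c = 0 <-> exists u, c = res_aug u;
  res_exactS : forall n c,
    res_diff n.+1 c = 0 <-> exists b, c = res_diff n b;
  res_injective : forall n, injective_module (res_obj n)
}.

Section LocalCohomology.
Variables (I : ideal R) (M : lmodType R) (C : injective_resolution M).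

(* Cocycles and coboundaries of the complex Gamma_I(C). *)
Definition cocycle n : {pred C n} :=
  fun c => (c \in Gamma I (C n)) && (res_diff C n c == 0).
Arguments cocycle n c : clear implicits.

Lemma cocycle_closed n : submod_closed (cocycle n).
Proof.
split=> [|a u v /andP[uG /eqP u0] /andP[vG /eqP v0]]; apply/andP.
  by rewrite rpred0 raddf0.
by rewrite rpredD ?rpredZ // linearP u0 v0 scaler0 addr0.
Qed.
HB.instance Definition _ n :=
  GRing.isSubmodClosed.Build R (C n) (cocycle n) (cocycle_closed n).

Definition coboundary n : {pred submod (cocycle n)} :=
  match n with
  | 0 => fun c => val c == 0
  | k.+1 => fun c =>
      `[< exists2 b, b \in Gamma I (C k) & val c = res_diff C k b >]
  end.
Arguments coboundary n c : clear implicits.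

Lemma coboundary_closed n : submod_closed (coboundary n).
Proof.
case: n => [|n]; split=> [|a u v].
- exact/eqP/raddf0.
- by move=> /eqP u0 /eqP v0; apply/eqP; rewrite linearP /= u0 v0 scaler0 addr0.
- by apply/asboolP; exists 0; rewrite ?rpred0 ?raddf0.
move=> /asboolP[b bG ub] /asboolP[c cG vc]; apply/asboolP.
exists (a *: b + c); first by rewrite rpredD ?rpredZ.
by rewrite linearP /= ub vc.
Qed.
HB.instance Definition _ n := GRing.isSubmodClosed.Build R
  (submod (cocycle n)) (coboundary n) (coboundary_closed n).

(* H^n_I(M), the n-th right derived functor of Gamma_I, computed with C. *)
Definition local_cohomology n : lmodType R := quotmod (coboundary n).

End LocalCohomology.

Section DirectLimit.
Variables (M : nat -> lmodType R) (t : forall l, {linear M l -> M l.+1}).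

Definition seqmod := forall l, M l.
HB.instance Definition _ := Choice.on seqmod.

Definition seqmod_add (u v : seqmod) : seqmod := fun l => u l + v l.
Definition seqmod_opp (u : seqmod) : seqmod := fun l => - u l.
Definition seqmod_zero : seqmod := fun l => 0.
Definition seqmod_scale (a : R) (u : seqmod) : seqmod := fun l => a *: u l.

Lemma funext_dep (u v : seqmod) : (forall l, u l = v l) -> u = v.
Proof. exact: functional_extensionality_dep. Qed.

Lemma seqmod_addA : associative seqmod_add.
Proof. by move=> u v w; apply: funext_dep => l; exact: addrA. Qed.
Lemma seqmod_addC : commutative seqmod_add.
Proof. by move=> u v; apply: funext_dep => l; exact: addrC. Qed.
Lemma seqmod_add0 : left_id seqmod_zero seqmod_add.
Proof. by move=> u; apply: funext_dep => l; exact: add0r. Qed.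
Lemma seqmod_addN : left_inverse seqmod_zero seqmod_opp seqmod_add.
Proof. by move=> u; apply: funext_dep => l; exact: addNr. Qed.
HB.instance Definition _ := GRing.isZmodule.Build seqmod
  seqmod_addA seqmod_addC seqmod_add0 seqmod_addN.

Lemma seqmod_scaleA a b u :
  seqmod_scale a (seqmod_scale b u) = seqmod_scale (a * b) u.
Proof. by apply: funext_dep => l; exact: scalerA. Qed.
Lemma seqmod_scale1 : left_id 1 seqmod_scale.
Proof. by move=> u; apply: funext_dep => l; exact: scale1r. Qed.
Lemma seqmod_scaleDr : right_distributive seqmod_scale +%R.
Proof. by move=> a u v; apply: funext_dep => l; exact: scalerDr. Qed.
Lemma seqmod_scaleDl u : {morph seqmod_scale^~ u : a b / a + b}.
Proof. by move=> a b; apply: funext_dep => l; exact: scalerDl. Qed.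
HB.instance Definition _ := GRing.Zmodule_isLmodule.Build R seqmod
  seqmod_scaleA seqmod_scale1 seqmod_scaleDr seqmod_scaleDl.

(* The direct limit of M 0 -> M 1 -> M 2 -> ... is realised as the module of
   eventually compatible sequences modulo the eventually zero ones; see
   [dirlim_in], [dirlim_inS], [dirlim_surj] and [dirlim_in_eq0]. *)
Definition ev_compat : {pred seqmod} :=
  fun u => `[< exists n, forall l, (n <= l)%N -> u l.+1 = t l (u l) >].

Lemma ev_compat_closed : submod_closed ev_compat.
Proof.
split=> [|a u v /asboolP[n nu] /asboolP[p pv]]; apply/asboolP.
  by exists 0 => l _; rewrite raddf0.
exists (maxn n p) => l; rewrite geq_max => /andP[nl pl].
by rewrite /GRing.add /= /seqmod_add linearP -nu // -pv.
Qed.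
HB.instance Definition _ :=
  GRing.isSubmodClosed.Build R seqmod ev_compat ev_compat_closed.

Definition ev_zero : {pred submod ev_compat} :=
  fun u => `[< exists n, forall l, (n <= l)%N -> val u l = 0 >].

Lemma ev_zero_closed : submod_closed ev_zero.
Proof.
split=> [|a u v /asboolP[n nu] /asboolP[p pv]]; apply/asboolP.
  by exists 0.
exists (maxn n p) => l; rewrite geq_max => /andP[nl pl].
rewrite linearP /= /GRing.add /= /seqmod_add /GRing.scale /= /seqmod_scale.
by rewrite nu // pv // scaler0 addr0.
Qed.
HB.instance Definition _ :=
  GRing.isSubmodClosed.Build R (submod ev_compat) ev_zero ev_zero_closed.

Definition dirlim : lmodType R := quotmod ev_zero.

(* The image of a : M l at stage k (zero if k < l). *)
Fixpoint push l (a : M l) k : M k :=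
  let up := match k return M k with 0 => 0 | k'.+1 => t k' (push a k') end in
  match @eqP _ l k with
  | ReflectT e => eq_rect l M a k e
  | ReflectF _ => up
  end.

Lemma push_id l (a : M l) : push a l = a.
Proof.
by case: l a => [|l] a /=; case: eqP => // e; rewrite (eq_irrelevance e erefl).
Qed.

Lemma push_lt l (a : M l) k : (k < l)%N -> push a k = 0.
Proof.
elim: k => [|k IHk] kl /=; case: eqP => [e|_] //.
- by rewrite e ltnn in kl.
- by rewrite -e ltnn in kl.
- by rewrite IHk ?raddf0 // ltnW.
Qed.

Lemma pushS l (a : M l) k : (l <= k)%N -> push a k.+1 = t k (push a k).
Proof. by move=> lk /=; case: eqP => // e; rewrite e ltnn in lk. Qed.

Lemma push_is_linear l : linear (fun a : M l => push a : seqmod).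
Proof.
move=> a u v; apply: funext_dep => k.
change (push (a *: u + v) k = a *: push u k + push v k).
elim: k => [|k IHk] /=; case: eqP => [e|_].
- by case: _ / e.
- by rewrite scaler0 addr0.
- by case: _ / e.
- by rewrite IHk linearP.
Qed.

Lemma push_compat l (a : M l) : (push a : seqmod) \in ev_compat.
Proof. by apply/asboolP; exists l => k; exact: pushS. Qed.

Definition dirlim_in l (a : M l) : dirlim :=
  quot_pr ev_zero (Sub (push a : seqmod) (push_compat a)).

Lemma dirlim_in_is_linear l : linear (@dirlim_in l).
Proof.
move=> a u v; rewrite /dirlim_in -linearP; congr (quot_pr _ _).
by apply: val_inj; rewrite linearP /= push_is_linear.
Qed.
HB.instance Definition _ l :=
  GRing.isLinear.Build R (M l) dirlim _ (@dirlim_in l) (@dirlim_in_is_linear l).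

Lemma dirlim_eqP (u v : submod ev_compat) :
  quot_pr ev_zero u = quot_pr ev_zero v <->
  exists n, forall l, (n <= l)%N -> val u l = val v l.
Proof.
have -> : (quot_pr ev_zero u = quot_pr ev_zero v) <-> (u - v \in ev_zero).
  rewrite -(quot_pr_eq0 ev_zero) raddfB /= subr_eq0.
  by split=> [->|/eqP].
split=> [/asboolP[n nuv]|[n nuv]]; [|apply/asboolP]; exists n => l nl.
  by have /eqP := nuv l nl; rewrite raddfB /= subr_eq0 => /eqP.
by rewrite raddfB /=; apply/eqP; rewrite subr_eq0 nuv.
Qed.

Lemma dirlim_inS l (a : M l) : dirlim_in (t l a) = dirlim_in a.
Proof.
apply/dirlim_eqP; exists l.+1 => k /=.
elim: k => // k IHk; rewrite ltnS leq_eqVlt => /orP[/eqP lk|lk].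
  by subst k; rewrite (pushS a (leqnn l)) !push_id.
by rewrite (pushS _ lk) (pushS a (ltnW lk)) IHk.
Qed.

Lemma dirlim_surj (z : dirlim) : exists l (a : M l), z = dirlim_in a.
Proof.
have [u ->] := quot_pr_surj z; have /asboolP[n nu] := valP u.
exists n, (val u n); apply/dirlim_eqP; exists n => k /=; elim: k => [|k IHk].
  by rewrite leqn0 => /eqP n0; subst n; rewrite push_id.
rewrite leq_eqVlt => /orP[/eqP n0|nk]; first by subst n; rewrite push_id.
by rewrite pushS // -IHk //; exact: nu.
Qed.

Lemma dirlim_in_eq0 l (a : M l) :
  dirlim_in a = 0 <-> exists2 k, (l <= k)%N & push a k = 0.
Proof.
rewrite -(raddf0 (quot_pr ev_zero)); split=> [/dirlim_eqP[n na]|[k lk a0]].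
  by exists (maxn l n); [exact: leq_maxl | exact: (na _ (leq_maxr l n))].
apply/dirlim_eqP; exists k => p /= kp; rewrite -(subnK kp).
elim: (p - k)%N => [//|q IHq]; rewrite addSn pushS ?IHq ?raddf0 //.
exact: leq_trans lk (leq_addl _ _).
Qed.

End DirectLimit.

Section TopLocalCohomology.
Variables (h : nat) (x : 'I_h -> R).

Definition pow_seq l : 'I_h -> R := fun i => x i ^+ l.

Section Module.
Variable M : lmodType R.

(* M / (x_1^l, ..., x_h^l) M; the direct system starts at l = 1, so that its
   term of index 0 is M / xM by conversion. *)
Definition pow_quot l : lmodType R := quotmod (gen M (pow_seq l)).

Lemma gen_pow_seqS l (u : M) :
  u \in gen M (pow_seq l) -> (\prod_i x i) *: u \in gen M (pow_seq l.+1).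
Proof.
move=> /asboolP[v ->]; apply/asboolP.
exists (fun i => (\prod_(j | j != i) x j) *: v i).
rewrite scaler_sumr; apply: eq_bigr => i _; rewrite !scalerA /pow_seq.
by rewrite (bigD1 i) //= exprS mulrAC.
Qed.

(* Multiplication by x_1 ... x_h. *)
Definition pow_trans l (u : pow_quot l) : pow_quot l.+1 :=
  quot_pr (gen M (pow_seq l.+1)) ((\prod_i x i) *: repr u).

Lemma pow_trans_pr l (u : M) :
  pow_trans (quot_pr (gen M (pow_seq l)) u) =
  quot_pr (gen M (pow_seq l.+1)) ((\prod_i x i) *: u).
Proof.
apply/eqP; rewrite /pow_trans -subr_eq0 -raddfB -scalerBr quot_pr_eq0.
apply: gen_pow_seqS; rewrite -(quot_pr_eq0 (gen M (pow_seq l))) raddfB /=.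
by rewrite /quot_pr reprK subrr.
Qed.

Lemma pow_trans_is_linear l : linear (@pow_trans l).
Proof.
move=> a u v; have [u' ->] := quot_pr_surj u; have [v' ->] := quot_pr_surj v.
by rewrite -linearP !pow_trans_pr -linearP /= scalerDr !scalerA mulrC.
Qed.
HB.instance Definition _ l := GRing.isLinear.Build R (pow_quot l)
  (pow_quot l.+1) _ (@pow_trans l) (@pow_trans_is_linear l).

(* H^h_{xR}(M) = colim_l M / (x_1^l, ..., x_h^l) M. *)
Definition top_cohomology : lmodType R :=
  @dirlim (fun l => pow_quot l.+1) (fun l => @pow_trans l.+1).

Definition iota_map : quotmod (gen M x) -> top_cohomology :=
  @dirlim_in (fun l => pow_quot l.+1) (fun l => @pow_trans l.+1) 0.

End Module.

Variable I : ideal R.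

(* The ideal J_{x,I}, i.e. the image in R of D(H^h_{xR}(D(H^h_I(R)))). *)
Definition Jideal : {pred R^o} := fun r =>
  `[< forall l, exists s, forall a, a \in ideal_pow I s ->
        r * a \in gen R^o (pow_seq l) >].

Lemma Jideal_closed : submod_closed Jideal.
Proof.
split=> [|b r r' /asboolP rJ /asboolP r'J]; apply/asboolP => l.
  by exists 0 => a _; rewrite mul0r rpred0.
have [s rs] := rJ l; have [t rt] := r'J l; exists (maxn s t) => a aI.
rewrite mulrDl -mulrA rpredD ?rt ?(ideal_pow_le _ aI) ?leq_maxr //.
by apply: (rpredZ b); rewrite rs ?(ideal_pow_le _ aI) ?leq_maxl.
Qed.
HB.instance Definition _ :=
  GRing.isSubmodClosed.Build R R^o Jideal Jideal_closed.

Lemma Jideal_Gamma (r : submod Jideal) :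
  quot_pr (gen R^o x) (val r) \in Gamma I (quotmod (gen R^o x)).
Proof.
have /asboolP/(_ 1) [s rs] := valP r; apply/asboolP; exists s => a aI.
rewrite -linearZ; apply/eqP; rewrite quot_pr_eq0.
by have -> : a *: val r = (val r : R) * a by [exact: mulrC]; exact: rs.
Qed.

(* The restriction to J_{x,I} of the projection R -> R/xR, as a map to
   Gamma_I(R/xR). *)
Definition jmap (r : submod Jideal) : submod (Gamma I (quotmod (gen R^o x))) :=
  Sub (quot_pr (gen R^o x) (val r)) (Jideal_Gamma r).

End TopLocalCohomology.

End Modules.

(* Main.v *)
(* Write H = H^h_I(R), X = x_1 ... x_h and J_l = (x^l R : I^oo).

   Since E is an injective cogenerator, (y_1, ..., y_k) D consists of the
   functionals on H that vanish on 0 :_H y. Hence (ii) says that H <> 0 is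
   x-coregular (each x_i is surjective on 0 :_H (x_1, ..., x_(i-1))), and
   (iii) says that X^l maps 0 :_H x^(l+1) onto 0 :_H x for all l (the
   predicate [lifts]). The latter implies coregularity, by induction on
   exponents.

   For an injective resolution C of R, the complex 0 :_C x has cohomology only
   in degree h, where it is R/x, generated by a class c; moreover c = X^l c'
   with c' killed by x^(l+1). Its terms in degrees below h split off, so
   Gamma_I is exact there and H^h(0 :_(Gamma_I C) x) = 0 :_H x = J_1/x.
   An element of 0 :_H x is thus r c with r in J_1; under (iv) one may take r
   in J, and then r c' is an element of H witnessing [lifts].

   If H is coregular, the vanishing of H^l_I(R) for l > h passes to
   0 :_(Gamma_I C) x, so that Q = (0 :_C x) / Gamma_I has cohomology only in
   degree h, namely R/J_1. The Koszul complex of generators of I with values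
   in Q^i is exact for every i, and a zigzag shows that R/J_1 = I (R/J_1),
   hence R = J_1: a power of I lies in xR, which is (i). *)

Require Import Defs.
From HB Require Import structures.
From mathcomp Require Import all_boot all_algebra.
From mathcomp Require Import ring_quotient generic_quotient.
From mathcomp Require Import boolp classical_sets functions.

Set Implicit Arguments.
Unset Strict Implicit.
Unset Printing Implicit Defensive.

Import GRing.Theory.
Local Open Scope ring_scope.

(** * Submodules and extension of linear maps *)

Section Submodules.
Variable R : comNzRingType.

(** Submodules are [Prop]-valued predicates, so that annihilators, torsion parts and images can be
    nested freely; [subm_closed] leads back to library submodules. *)
Definition subm (V : lmodType R) (W : V -> Prop) :=
  W 0 /\ forall a u v, W u -> W v -> W (a *: u + v).

Section Closure.
Variables (V : lmodType R) (W : V -> Prop) (sW : subm W).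

Lemma subm0 : W 0. Proof. by case: sW. Qed.

Lemma submD u v : W u -> W v -> W (u + v).
Proof. by case: sW => _ H Wu Wv; rewrite -[u]scale1r; apply: H. Qed.

Lemma submZ a u : W u -> W (a *: u).
Proof. by case: sW => W0 H Wu; rewrite -[_ *: _]addr0; apply: H. Qed.

Lemma submN u : W u -> W (- u).
Proof. by move=> Wu; rewrite -scaleN1r; apply: submZ. Qed.

Lemma submB u v : W u -> W v -> W (u - v).
Proof. by move=> Wu Wv; apply: submD => //; apply: submN. Qed.

Lemma subm_sum (I : Type) (r : seq I) (P : pred I) (F : I -> V) :
  (forall i, P i -> W (F i)) -> W (\sum_(i <- r | P i) F i).
Proof. by move=> WF; apply: big_ind => //; [exact: subm0 | exact: submD]. Qed.

Definition subm_pred of subm W : {pred V} := fun u => `[< W u >].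

Lemma subm_pred_closed : submod_closed (subm_pred sW).
Proof.
split=> [|a u v /asboolP Wu /asboolP Wv]; apply/asboolP; first exact: subm0.
exact: (proj2 sW).
Qed.

HB.instance Definition _ :=
  GRing.isSubmodClosed.Build R V (subm_pred sW) subm_pred_closed.

Definition subm_closed : submodClosed V := subm_pred sW.

Lemma in_subm_closed u : u \in subm_closed <-> W u.
Proof. by split=> [/asboolP|Wu]; [|apply/asboolP]. Qed.

End Closure.

Lemma subm_mem (V : lmodType R) (S : submodClosed V) : subm (fun u => u \in S).
Proof. by split=> [|a u v uS vS]; rewrite ?rpred0 ?rpredD ?rpredZ. Qed.

Lemma submI (V : lmodType R) (W W' : V -> Prop) :
  subm W -> subm W' -> subm (fun u => W u /\ W' u).
Proof.
move=> [W0 WD] [W0' WD']; split=> // a u v [Wu Wu'] [Wv Wv'].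
by split; [apply: WD | apply: WD'].
Qed.

Lemma subm_image (U V : lmodType R) (f : {linear U -> V}) (W : U -> Prop) :
  subm W -> subm (fun v => exists2 u, W u & v = f u).
Proof.
move=> sW; split=> [|a _ _ [u Wu ->] [v Wv ->]].
  by exists 0; [exact: subm0 | rewrite raddf0].
by exists (a *: u + v); [exact: (proj2 sW) | rewrite linearP].
Qed.

Lemma subm_full (V : lmodType R) : subm (fun _ : V => True).
Proof. by []. Qed.

Lemma subm_zero (V : lmodType R) : subm (fun u : V => u = 0).
Proof. by split=> // a u v -> ->; rewrite scaler0 addr0. Qed.

Lemma subm_kill (V : lmodType R) (x : R) : subm (fun u : V => x *: u = 0).
Proof.
split=> [|a u v u0 v0]; first by rewrite scaler0.
by rewrite scalerDr v0 !scalerA mulrC -scalerA u0 scaler0 addr0.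
Qed.

Section Extension.
Variables (E V : lmodType R) (W : V -> Prop) (f : V -> E).
Hypothesis sW : subm W.
Hypothesis lf : forall a u v, W u -> W v -> f (a *: u + v) = a *: f u + f v.

Let sub_fun (u : submod (subm_closed sW)) : E := f (val u).

Let sub_fun_linear : linear sub_fun.
Proof.
move=> a u v; rewrite /sub_fun linearP lf //.
  exact/asboolP/(valP u).
exact/asboolP/(valP v).
Qed.

HB.instance Definition _ :=
  GRing.isLinear.Build R (submod (subm_closed sW)) E _ sub_fun sub_fun_linear.

(** Here [f] is linear on [W] only and arbitrary elsewhere, so it may come from a choice of
    preimages. *)
Lemma extend_linear :
  injective_module E -> exists g : {linear V -> E}, forall u, W u -> g u = f u.
Proof.
move=> injE.
have [g gE] := injE _ _ (val : {linear submod (subm_closed sW) -> V})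
  (sub_fun : {linear _ -> E}) val_inj.
exists g => u /asboolP Wu; exact: (gE (Sub u Wu)).
Qed.

End Extension.

End Submodules.

(** * Noetherian rings *)

Section Noetherian.
Variable R : comNzRingType.
Local Open Scope classical_set_scope.
Local Notation "'idl' J" := (subm (J : R^o -> Prop)) (at level 10).

Lemma proper_sub_maximal (m : ideal R) (J : R^o -> Prop) :
  local_ring m -> idl J -> ~ J 1 -> forall r, J r -> r \in m.
Proof.
move=> [[mprop mmax] muniq] sJ J1 r Jr; apply: contrapT => rm.
(* Zorn runs over the sets B whose union with J is a proper ideal; keeping J in the union covers the
   empty chain. *)
pose P (B : set R^o) := idl (J `|` B) /\ ~ (J `|` B) 1.
have [F FP totF|A [[sA A1] Amax]] := @Zorn_bigcup R^o P.
  split; last by move=> [//|[X /FP[_ X1] X1']]; apply: X1; right.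
  split=> [|a u v Ju Jv]; first by left; exact: subm0.
  have inX X w : F X -> (J `|` X) w -> (J `|` \bigcup_(X in F) X) w.
    by move=> FX [?|?]; [left | right; exists X].
  case: Ju Jv => [Ju|[X FX Xu]] [Jv|[Y FY Yv]].
  - by left; apply: (proj2 sJ).
  - by apply: (inX Y) => //; apply: (proj2 (proj1 (FP _ FY))); [left | right].
  - by apply: (inX X) => //; apply: (proj2 (proj1 (FP _ FX))); [right | left].
  case: (totF _ _ FX FY) => XY.
    apply: (inX Y) => //; apply: (proj2 (proj1 (FP _ FY))); right=> //.
    exact: XY.
  apply: (inX X) => //; apply: (proj2 (proj1 (FP _ FX))); right=> //.
  exact: XY.
have maxA : maximal_ideal (subm_closed sA).
  split=> [|K K1 AK s]; first by apply/negP => /(in_subm_closed sA 1).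
  apply/idP/idP => [sK|/AK//]; apply/in_subm_closed; apply: contrapT => sA'.
  have JK : forall t, (J `|` [set t | t \in K]) t <-> t \in K.
    by move=> t; split=> [[Jt|//]|]; [apply/AK/in_subm_closed; left | right].
  apply: (Amax [set t | t \in K]).
    split=> [t At|KA]; first by apply/AK/in_subm_closed; right.
    by apply: sA'; right; apply: KA.
  have JKE : (J `|` [set t | t \in K]) = (fun t => t \in K).
    by apply: funext => t; apply: propext; exact: JK.
  by rewrite /P JKE; split; [exact: subm_mem | exact/negP].
by apply: rm; rewrite -(muniq _ maxA); apply/in_subm_closed; left.
Qed.

Lemma noetherian_acc (noethR : noetherian R) (A : nat -> R^o -> Prop) :
  (forall n, idl (A n)) -> (forall n r, A n r -> A n.+1 r) ->
  exists n, forall k r, A k r -> A n r.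
Proof.
move=> sA incA.
have leA n k r : (n <= k)%N -> A n r -> A k r.
  move/subnK <-; elim: (k - n)%N => // p IHp /IHp.
  by rewrite addSn; apply: incA.
have sU : subm (fun r : R^o => exists n, A n r).
  split=> [|a u v [n un] [k vk]]; first by exists 0; exact: subm0.
  exists (maxn n k); apply: (proj2 (sA _)).
    exact: leA (leq_maxl _ _) un.
  exact: leA (leq_maxr _ _) vk.
pose U : ideal R := subm_closed sU.
have [k [y Uy]] := noethR U.
have yU i : exists n, A n (y i).
  apply/asboolP; change (y i \in U); rewrite Uy; apply/asboolP.
  exists (fun j => (i == j)%:R); rewrite (bigD1 i) //= big1 ?addr0.
    by rewrite eqxx [_ *: _]mulr1.
  by move=> j; rewrite eq_sym => /negPf ->; rewrite scaler0.
have [n nP] := choice yU.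
exists (\max_i n i) => j r rj.
have : r \in U by apply/asboolP; exists j.
rewrite Uy => /asboolP[v ->]; apply: subm_sum => // i _.
rewrite [_ *: _]mulrC; apply: submZ => //.
exact: leA (leq_bigmax i) (nP i).
Qed.

End Noetherian.

(** * Injectivity, torsion and coregular sequences *)

Section Baer.
Variable R : comNzRingType.
Implicit Types (V : lmodType R) (x y : R) (xs ys : seq R) (a : R^o -> Prop).

Definition kill1 V (A : V -> Prop) x : V -> Prop :=
  fun u => A u /\ x *: u = 0.

Fixpoint kill V (A : V -> Prop) xs : V -> Prop :=
  if xs is x :: xs' then kill (kill1 A x) xs' else A.

Definition tors1 V (A : V -> Prop) y : V -> Prop :=
  fun u => A u /\ exists s, y ^+ s *: u = 0.

Fixpoint tors V (A : V -> Prop) ys : V -> Prop :=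
  if ys is y :: ys' then tors (tors1 A y) ys' else A.

(** Membership in the ideal a + xR; [addi a xs] is then a + (xs). *)
Definition add1 a x : R^o -> Prop := fun r => exists t, a (r - x * t).

Fixpoint addi a xs : R^o -> Prop :=
  if xs is x :: xs' then addi (add1 a x) xs' else a.

(** Regularity of [xs] on R/a, without the condition that R/(a + (xs)) is nonzero. *)
Fixpoint regular_mod a xs : Prop :=
  if xs is x :: xs' then
    (forall r, a (x * r) -> a r) /\ regular_mod (add1 a x) xs'
  else True.

(* Dual to regularity: each x_i is surjective on 0 :_A (x_1, ..., x_(i-1)). *)
Fixpoint coregular V (A : V -> Prop) xs : Prop :=
  if xs is x :: xs' then
    (forall u, A u -> exists2 v, A v & x *: v = u) /\ coregular (kill1 A x) xs'
  else True.

Lemma killP V (A : V -> Prop) xs u :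
  kill A xs u <-> A u /\ forall x, x \in xs -> x *: u = 0.
Proof.
elim: xs A => [|x xs IH] A /=; first by split=> [|[]].
rewrite IH /kill1; split=> [[[Au xu] H]|[Au H]].
  by split=> // z; rewrite inE => /orP[/eqP ->|/H].
split; [split=> //|move=> z zx]; apply: H; by rewrite inE ?eqxx ?zx ?orbT.
Qed.

Lemma torsP V (A : V -> Prop) ys u :
  tors A ys u <-> A u /\ forall y, y \in ys -> exists s, y ^+ s *: u = 0.
Proof.
elim: ys A => [|y ys IH] A /=; first by split=> [|[]].
rewrite IH /tors1; split=> [[[Au xu] H]|[Au H]].
  by split=> // z; rewrite inE => /orP[/eqP ->|/H].
split; [split=> //|move=> z zx]; apply: H; by rewrite inE ?eqxx ?zx ?orbT.
Qed.

Lemma subm_kill1 V (A : V -> Prop) x : subm A -> subm (kill1 A x).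
Proof. by move=> sA; apply: submI => //; exact: subm_kill. Qed.

Lemma subm_killl V (A : V -> Prop) xs : subm A -> subm (kill A xs).
Proof. by elim: xs A => //= x xs IH A sA; apply/IH/subm_kill1. Qed.

Lemma scale_pow_le V (u : V) y s k :
  (s <= k)%N -> y ^+ s *: u = 0 -> y ^+ k *: u = 0.
Proof. by move=> /subnK <- H; rewrite exprD -scalerA H scaler0. Qed.

Lemma subm_tors1 V (A : V -> Prop) y : subm A -> subm (tors1 A y).
Proof.
move=> sA; apply: submI => //; split=> [|r u v [s us] [t vt]].
  by exists 0; rewrite scaler0.
exists (maxn s t); rewrite scalerDr scalerA mulrC -scalerA.
rewrite (scale_pow_le (leq_maxl s t) us) (scale_pow_le (leq_maxr s t) vt).
by rewrite scaler0 addr0.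
Qed.

Lemma subm_tors V (A : V -> Prop) ys : subm A -> subm (tors A ys).
Proof. by elim: ys A => //= y ys IH A sA; apply/IH/subm_tors1. Qed.

Lemma subm_add1 a x : subm a -> subm (add1 a x).
Proof.
move=> sa; split=> [|r u v [s us] [t vt]].
  by exists 0; rewrite mulr0 subr0; exact: subm0.
exists (r * s + t).
have -> : r *: u + v - x * (r * s + t)
    = r *: (u - x * s : R^o) + (v - x * t).
  by rewrite scalerBr addrACA mulrDr opprD mulrCA.
exact: (proj2 sa).
Qed.

Lemma add1_sub a x r : a r -> add1 a x r.
Proof. by exists 0; rewrite mulr0 subr0. Qed.

Definition annihilates V a (W : V -> Prop) :=
  forall r u, a r -> W u -> r *: u = 0.

Lemma annihilates_kill1 V a (W : V -> Prop) x :
  annihilates a W -> annihilates (add1 a x) (kill1 W x).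
Proof.
move=> aW r u [t rt] [Wu xu]; have /eqP := aW _ _ rt Wu.
by rewrite scalerBl mulrC -scalerA xu scaler0 subr0 => /eqP.
Qed.

(* W is injective for inclusions of ideals of R/a, in the form of Baer's
   criterion. *)
Definition baer V a (W : V -> Prop) :=
  forall (N : R^o -> Prop) (F : R^o -> V),
    subm N -> (forall r, a r -> N r) -> (forall r, N r -> W (F r)) ->
    (forall c r s, N r -> N s -> F (c * r + s) = c *: F r + F s) ->
    (forall r, a r -> F r = 0) ->
    exists2 w, W w & forall r, N r -> F r = r *: w.

Lemma baer_injective (E : lmodType R) :
  injective_module E -> baer (fun r => r = 0) (fun _ : E => True).
Proof.
move=> injE N F sN _ _ lF _.
have [g gE] := extend_linear sN lF injE.
exists (g 1) => // r Nr; rewrite -linearZ /= -gE //; congr (g _).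
by rewrite [_ *: _]mulr1.
Qed.

(** A map that vanishes on a + xR vanishes at x, so the element w that represents it is killed by
    x. *)
Lemma baer_kill1 V a (W : V -> Prop) x :
  subm a -> baer a W -> baer (add1 a x) (kill1 W x).
Proof.
move=> sa bW N F sN aN NW lF aF.
have [|||w Ww wF] := bW N F sN _ _ lF.
- by move=> r /(add1_sub x)/aN.
- by move=> r /NW[].
- by move=> r /(add1_sub x)/aF.
have xa : add1 a x x by exists 1; rewrite mulr1 subrr; exact: subm0.
by exists w => //; split=> //; rewrite -wF ?aF //; exact: aN.
Qed.

Lemma subm_addi a xs : subm a -> subm (addi a xs).
Proof. by elim: xs a => //= x xs IH a sa; apply/IH/subm_add1. Qed.

Lemma annihilates_kill V a (W : V -> Prop) xs :
  annihilates a W -> annihilates (addi a xs) (kill W xs).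
Proof. by elim: xs a W => //= x xs IH a W aW; apply/IH/annihilates_kill1. Qed.

Lemma baer_kill V a (W : V -> Prop) xs :
  subm a -> baer a W -> baer (addi a xs) (kill W xs).
Proof.
elim: xs a W => //= x xs IH a W sa bW; apply: IH; first exact: subm_add1.
exact: baer_kill1.
Qed.

(* The ideal [a + x R] is mapped to W by [x r + b |-> r u]. *)
Lemma baer_divide V a (W : V -> Prop) x u :
  subm a -> subm W -> annihilates a W -> baer a W -> W u ->
  (forall r, a (x * r) -> r *: u = 0) ->
  exists2 v, W v & x *: v = u.
Proof.
move=> sa sW aW bW Wu xu.
have /choice[f fP] : forall r : R^o, exists t, add1 a x r -> a (r - x * t).
  move=> r; have [[t rt]|nr] := pselect (add1 a x r); first by exists t.
  by exists 0.
(* Two choices of t for the same r differ by an element of a : x, which kills u. *)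
have fE r t : a (r - x * t) -> f r *: u = t *: u.
  move=> rt; apply/eqP; rewrite -subr_eq0 -scalerBl; apply/eqP/xu.
  have -> : x * (f r - t) = (r - x * t) - (r - x * f r).
    by rewrite mulrBr opprB [RHS]addrC addrA subrK.
  by apply: (submB sa) => //; apply: fP; exists t.
have [|c r s [t rt] [t' st']||v Wv vE] :=
    bW _ (fun r => f r *: u) (subm_add1 x sa) (fun r => @add1_sub a x r).
- by move=> r _; apply: submZ.
- have H : add1 a x r by exists t.
  have H' : add1 a x s by exists t'.
  rewrite scalerA -scalerDl; apply: fE.
  have -> : c * r + s - x * (c * f r + f s)
    = c * (r - x * f r) + (s - x * f s).
    by rewrite mulrDr mulrBr opprD addrACA mulrCA.
  by apply: (submD sa); [apply: (submZ sa) | ]; apply: fP.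
- by move=> r ar; rewrite (fE r 0) ?scale0r // mulr0 subr0.
exists v => //; rewrite -vE.
  by rewrite (fE x 1) ?scale1r // mulr1 subrr; exact: (subm0 sa).
by exists 1; rewrite mulr1 subrr; exact: (subm0 sa).
Qed.

Lemma baer_coregular V a (W : V -> Prop) xs :
  subm a -> subm W -> annihilates a W -> baer a W -> regular_mod a xs ->
  coregular W xs.
Proof.
elim: xs a W => //= x xs IH a W sa sW aW bW [xreg xsreg]; split=> [u Wu|].
  by apply: (baer_divide (a := a)) => // r /xreg ar; apply: aW.
apply: (IH (add1 a x)) => //.
- exact: subm_add1.
- exact: subm_kill1.
- exact: annihilates_kill1.
- exact: baer_kill1.
Qed.

(** * Torsion submodules over a noetherian ring *)

Section Noeth.
Hypothesis noethR : noetherian R.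

Lemma subm_colon a y n : subm a -> subm (fun r : R^o => a (y ^+ n * r)).
Proof.
move=> sa; split=> [|r u v Hu Hv]; first by rewrite mulr0; exact: (subm0 sa).
by rewrite mulrDr mulrCA; apply: (submD sa) => //; apply: (submZ sa).
Qed.

Lemma colon_stable a y : subm a ->
  exists n, forall k r, a (y ^+ k * r) -> a (y ^+ n * r).
Proof.
move=> sa; have [n nP] := noetherian_acc noethR
  (fun n => subm_colon y n sa) (fun n r (H : a (y ^+ n * r)) =>
    eq_ind_r a (submZ sa y H) (etrans (congr1 (fun z => z * r) (exprS y n))
      (esym (mulrA y (y ^+ n) r)))).
by exists n.
Qed.

Lemma annihilates_sub V a (W W' : V -> Prop) :
  (forall u, W' u -> W u) -> annihilates a W -> annihilates a W'.
Proof. by move=> WW aW r u ar /WW; apply: aW. Qed.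

(** By noetherianity a single power of y kills the image of F, and for some t the ideal y^t R meets
    N inside the kernel of F. Hence F extends to N + y^t R by zero on y^t R, and the w that
    represents this extension is killed by y^t. *)
Lemma baer_tors1 V a (W : V -> Prop) y :
  subm a -> subm W -> annihilates a W -> baer a W -> baer a (tors1 W y).
Proof.
move=> sa sW aW bW N F sN aN NW lF aF.
have F0 : F 0 = 0 by apply: aF; exact: (subm0 sa).
have FZ c r : N r -> F (c * r) = c *: F r.
  by move=> Nr; rewrite -[c * r]addr0 lF ?F0 ?addr0 //; exact: (subm0 sN).
have FD r s : N r -> N s -> F (r + s) = F r + F s.
  by move=> Nr Ns; rewrite -[r in LHS]mul1r lF ?scale1r.
have [s sF] : exists s, forall r, N r -> y ^+ s *: F r = 0.
  pose B n (r : R^o) := N r /\ y ^+ n *: F r = 0.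
  have sB n : subm (B n).
    split=> [|c u v [Nu Fu] [Nv Fv]].
      by split; [exact: (subm0 sN) | rewrite F0 scaler0].
    split; first exact: (proj2 sN).
    by rewrite lF // scalerDr Fv scalerA mulrC -scalerA Fu scaler0 addr0.
  have [s sP] := noetherian_acc noethR sB
    (fun n r (H : B n r) => conj (proj1 H)
       (scale_pow_le (leqnSn n) (proj2 H))).
  exists s => r Nr; have [_ [k Fk]] := NW r Nr.
  by apply: (proj2 (sP k r _)).
pose N0 (r : R^o) := N r /\ F r = 0.
have sN0 : subm N0.
  split=> [|c u v [Nu Fu] [Nv Fv]]; first by split=> //; exact: (subm0 sN).
  by split; [exact: (proj2 sN) | rewrite lF // Fu Fv scaler0 addr0].
(* Artin-Rees: [y^t R] meets N inside the kernel of F. *)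
have [t tP] := colon_stable y sN0.
have AR r : N (y ^+ t * r) -> F (y ^+ t * r) = 0.
  move=> Nr; apply: (proj2 (tP (s + t)%N r _)).
  by rewrite exprD -mulrA; split; [apply: (submZ sN) | rewrite FZ ?sF].
pose N' := add1 N (y ^+ t).
have /choice[f fP] : forall r : R^o, exists q, N' r -> N (r - y ^+ t * q).
  move=> r; have [[q rq]|nr] := pselect (N' r); first by exists q.
  by exists 0.
have fE r q : N (r - y ^+ t * q) -> F (r - y ^+ t * f r) = F (r - y ^+ t * q).
  move=> rq; have H : N (r - y ^+ t * f r) by apply: fP; exists q.
  apply/eqP; rewrite -subr_eq0; apply/eqP.
  have E : (r - y ^+ t * f r) - (r - y ^+ t * q) = y ^+ t * (q - f r).
    by rewrite opprB addrC addrA subrK mulrBr.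
  have <- : F ((r - y ^+ t * f r) - (r - y ^+ t * q)) =
      F (r - y ^+ t * f r) - F (r - y ^+ t * q).
    rewrite FD //; last exact: (submN sN).
    by rewrite -[- (r - _)]mulN1r FZ // scaleN1r.
  by rewrite E AR // -E; apply: (submB sN).
have [|||c r s' H H'||w Ww wF] :=
    bW N' (fun r => F (r - y ^+ t * f r)).
- exact: subm_add1.
- by move=> r /aN; apply: add1_sub.
- by move=> r H; apply: (proj1 (NW _ _)); exact: fP.
- have E : c * r + s' - y ^+ t * (c * f r + f s')
      = c * (r - y ^+ t * f r) + (s' - y ^+ t * f s').
    by rewrite mulrDr mulrBr opprD addrACA mulrCA.
  have HN : N (c * r + s' - y ^+ t * (c * f r + f s')).
    by rewrite E; apply: (proj2 sN); exact: fP.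
  by rewrite (fE _ _ HN) E lF //; exact: fP.
- move=> r ar; rewrite (fE r 0) mulr0 subr0 //; first exact: aF.
  exact: aN.
exists w.
  split=> //; exists t; rewrite -wF.
    by rewrite (fE _ 1) mulr1 subrr //; exact: (subm0 sN).
  by exists 1; rewrite mulr1 subrr; exact: (subm0 sN).
move=> r Nr; rewrite -wF; last exact: add1_sub.
by rewrite (fE _ 0) mulr0 subr0.
Qed.

Lemma baer_tors V a (W : V -> Prop) ys :
  subm a -> subm W -> annihilates a W -> baer a W -> baer a (tors W ys).
Proof.
elim: ys W => //= y ys IH W sa sW aW bW; apply: IH => //.
- exact: subm_tors1.
- by apply: annihilates_sub aW => u [].
- exact: baer_tors1.
Qed.

(** Multiplication by y is surjective on W modulo its y-torsion: once the ideals a : y^n are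
    stationary, y^n u can be divided by y^(n+1). *)
Lemma baer_divide_tors V a (W : V -> Prop) y u :
  subm a -> subm W -> annihilates a W -> baer a W -> W u ->
  exists2 v, W v & tors1 W y (y *: v - u).
Proof.
move=> sa sW aW bW Wu; have [n nP] := colon_stable y sa.
have [||v Wv vE] := @baer_divide V a W (y ^+ n.+1) (y ^+ n *: u) sa sW aW bW.
- exact: submZ.
- by move=> r ar; rewrite scalerA mulrC; apply: aW => //; apply: nP ar.
exists v => //; split; first by apply: submB => //; apply: submZ.
by exists n; rewrite scalerBr scalerA -exprSr vE subrr.
Qed.

End Noeth.

(** Coregularity passes to the middle of the exact sequence 0 -> A' -> A -> A'' -> 0, whose second
    map is multiplication by x. The kernels of y again form such a sequence because y is surjective
    on A'. *)
Lemma coregular_ext V (A A' A'' : V -> Prop) x ys :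
  subm A -> subm A'' ->
  (forall u, A' u <-> A u /\ x *: u = 0) ->
  (forall u, A u -> A'' (x *: u)) ->
  (forall w, A'' w -> exists2 u, A u & x *: u = w) ->
  coregular A' ys -> coregular A'' ys -> coregular A ys.
Proof.
elim: ys A A' A'' => //= y ys IH A A' A'' sA sA'' AA' AA'' A''A.
move=> [yA' cA'] [yA'' cA'']; split=> [u Au|].
  have [w /A''A[v Av <-] yw] := yA'' _ (AA'' _ Au).
  have /yA'[v' /AA'[Av' xv'] yv'] : A' (u - y *: v).
    apply/AA'; split; first by apply: submB => //; apply: submZ.
    by rewrite scalerBr scalerA mulrC -scalerA yw subrr.
  exists (v + v'); first exact: submD.
  by rewrite scalerDr yv' addrC subrK.
apply: (IH (kill1 A y) (kill1 A' y) (kill1 A'' y)) => //.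
- exact: subm_kill1.
- exact: subm_kill1.
- by move=> u; rewrite /kill1 AA'; split=> [[[]]|[[]]].
- move=> u [Au yu]; split; first exact: AA''.
  by rewrite scalerA mulrC -scalerA yu scaler0.
move=> w [/A''A[u Au uw] yw].
have /yA'[v /AA'[Av xv] yv] : A' (y *: u).
  apply/AA'; split; first exact: submZ.
  by rewrite scalerA mulrC -scalerA uw.
exists (u - v); last by rewrite scalerBr xv subr0.
by split; [exact: submB | rewrite scalerBr yv subrr].
Qed.

Lemma surjective_pow V (A : V -> Prop) x n :
  (forall u, A u -> exists2 v, A v & x *: v = u) ->
  forall u, A u -> exists2 v, A v & x ^+ n *: v = u.
Proof.
move=> xA; elim: n => [|n IH] u Au; first by exists u; rewrite ?scale1r.
have [v Av <-] := xA u Au; have [w Aw <-] := IH v Av.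
by exists w; rewrite // exprS scalerA.
Qed.

Lemma coregular_eq0 V (A : V -> Prop) xs :
  subm A -> (forall u, A u -> u = 0) -> coregular A xs.
Proof.
elim: xs A => //= x xs IH A sA A0; split=> [u /A0 ->|].
  by exists 0; rewrite ?scaler0 //; exact: subm0.
by apply: IH; [exact: subm_kill1 | move=> u [/A0]].
Qed.

(** Induction along 0 -> 0:_A x -> 0:_A x^(n+1) -> 0:_A x^n -> 0, whose second map is multiplication
    by x. *)
Lemma coregular_kill_pow V (A : V -> Prop) x xs n :
  subm A -> (forall u, A u -> exists2 v, A v & x *: v = u) ->
  coregular (kill1 A x) xs -> coregular (kill1 A (x ^+ n)) xs.
Proof.
move=> sA xA cA; elim: n => [|n IH].
  apply: coregular_eq0; first exact: subm_kill1.
  by move=> u [_]; rewrite scale1r.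
apply: (coregular_ext (x := x)) cA IH; try exact: subm_kill1.
- move=> u; rewrite /kill1 exprSr -scalerA; split=> [[Au xu]|[[Au _]]] //.
  by rewrite xu scaler0.
- by move=> u [Au]; rewrite exprSr -scalerA => ?; split=> //; apply: submZ.
move=> w [Aw xw]; have [u Au uw] := xA w Aw.
by exists u => //; split=> //; rewrite exprSr -scalerA uw.
Qed.

Lemma coregular_pow V (A : V -> Prop) xs n :
  subm A -> coregular A xs -> coregular A [seq x ^+ n | x <- xs].
Proof.
elim: xs A => //= x xs IH A sA [xA cA]; split; first exact: surjective_pow.
by apply: IH; [exact: subm_kill1 | exact: coregular_kill_pow].
Qed.

End Baer.

(** * The complexes 0 :_A x *)

Section Complexes.
Variables (R : comNzRingType) (V : nat -> lmodType R).
Variable d : forall i, {linear V i -> V i.+1}.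
Hypothesis dd : forall i u, d i.+1 (d i u) = 0.

Implicit Types (A L : forall i, V i -> Prop) (x y : R) (xs ys : seq R).

Definition subcx A :=
  (forall i, subm (A i)) /\ forall i u, A i u -> A i.+1 (d i u).

(** With zero as the only boundary in degree 0, [exact_at A 0] says that d is injective on A in
    degree 0. *)
Definition bd A i : V i -> Prop :=
  if i is j.+1 then fun z => exists2 v, A j v & z = d j v
  else fun z => z = 0.

Definition exact_at A i := forall z, A i z -> d i z = 0 -> bd A z.

Definition killcx A xs i : V i -> Prop := kill (A i) xs.

Definition torscx A ys i : V i -> Prop := tors (A i) ys.

Definition coregcx A xs := forall i, coregular (A i) xs.

Lemma subm_bd A i : subcx A -> subm (@bd A i).
Proof.
move=> [sA _]; case: i => [|i]; first exact: subm_zero.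
exact: subm_image.
Qed.

Lemma bd_sub A i z : subcx A -> @bd A i z -> A i z.
Proof.
move=> [sA dA]; case: i z => [z ->|i z [v Av ->]]; last exact: dA.
exact: subm0.
Qed.

Lemma bd_cocycle A i z : @bd A i z -> d i z = 0.
Proof. by case: i z => [z ->|i z [v _ ->]]; rewrite ?raddf0. Qed.

Lemma subcx_kill1 A x : subcx A -> subcx (killcx A [:: x]).
Proof.
move=> [sA dA]; split=> i; first exact: subm_kill1.
by move=> u [Au xu]; split; [exact: dA | rewrite -linearZ /= xu raddf0].
Qed.

Lemma subcx_kill A xs : subcx A -> subcx (killcx A xs).
Proof. by elim: xs A => //= x xs IH A /(subcx_kill1 x); exact: IH. Qed.

Lemma subcx_tors A ys : subcx A -> subcx (torscx A ys).
Proof.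
move=> [sA dA]; split=> i; first exact: subm_tors.
move=> u /torsP[Au H]; apply/torsP; split; first exact: dA.
by move=> y /H[s us]; exists s; rewrite -linearZ /= us raddf0.
Qed.

(** * The long exact sequence of 0 -> 0:_A x -> A -> A -> 0 *)

Section Divisible.
Variables (A : forall i, V i -> Prop) (x : R).
Arguments A : clear implicits.
Hypotheses (cA : subcx A)
  (xA : forall i u, A i u -> exists2 v, A i v & x *: v = u).

Lemma bd_divide i z : @bd A i z -> exists2 w, bd A w & x *: w = z.
Proof.
case: i z => [z ->|i z [v Av ->]]; first by exists 0; rewrite ?scaler0.
have [w Aw <-] := xA Av; exists (d i w); last by rewrite linearZ.
by exists w.
Qed.

(** If z = d v, then x v is a cocycle one degree lower, hence a boundary x w with w a boundary; v -
    w is a primitive of z killed by x. *)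
Lemma bd_kill1 i z : (0 < i -> exact_at A i.-1)%N ->
  bd A z -> x *: z = 0 -> @bd (killcx A [:: x]) i z.
Proof.
case: cA => sA dA; case: i z => [//|i z] /(_ isT) /= exA [v Av ->] xv.
have [|w Aw xw] := @bd_divide i (x *: v).
  by apply: exA; [exact: submZ | rewrite linearZ].
exists (v - w); last by rewrite raddfB /= (bd_cocycle Aw) subr0.
split; last by rewrite scalerBr xw subrr.
by apply: submB => //; exact: bd_sub.
Qed.

Lemma exact_kill1 i : exact_at A i -> (0 < i -> exact_at A i.-1)%N ->
  exact_at (killcx A [:: x]) i.
Proof. by move=> exi exi1 z [Az xz] dz; apply: bd_kill1 => //; apply: exi. Qed.

(** Induction on the power of x that kills z: x z is a boundary x w with w a boundary, and z - w is
    a cocycle of 0:_A x. *)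
Lemma exact_unkill1 i :
  (forall u, A i u -> exists s, x ^+ s *: u = 0) ->
  exact_at (killcx A [:: x]) i -> exact_at A i.
Proof.
case: cA => sA dA tA exk z Az dz; have [s zs] := tA z Az.
have bdk u : bd (killcx A [:: x]) u -> @bd A i u.
  by case: (i) u => [//|j] u [v [Av _] ->]; exists v.
elim: s z Az dz zs => [|s IH] z Az dz.
  by rewrite scale1r => ->; apply: subm0; exact: subm_bd.
rewrite exprSr -scalerA => zs.
have [|w bw xw] := @bd_divide i (x *: z).
  by apply: IH => //; [exact: submZ | rewrite linearZ /= dz scaler0].
rewrite -[z](subrK w); apply: submD => //; first exact: subm_bd.
apply: bdk; apply: exk.
  split; last by rewrite scalerBr xw subrr.
  by apply: submB => //; exact: bd_sub.
by rewrite raddfB /= dz (bd_cocycle bw) subr0.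
Qed.

Lemma cocycle_lift_kill1 i z : A i z -> bd A (x *: z) ->
  exists2 z', killcx A [:: x] z' & @bd A i (z - z').
Proof.
case: cA => sA dA Az /bd_divide[w bw xw]; exists (z - w).
  split; last by rewrite scalerBr xw subrr.
  by apply: submB => //; exact: bd_sub.
by rewrite opprB addrC subrK.
Qed.

(** The cohomology of 0:_A x in degree i + 1 lies between the cokernel of x on H^i(A) and
    H^(i+1)(A); both vanish here. *)
Lemma exact_kill1_top i :
  (forall z, A i z -> d i z = 0 ->
    exists2 z', A i z' /\ d i z' = 0 & bd A (z - x *: z')) ->
  exact_at A i.+1 -> exact_at (killcx A [:: x]) i.+1.
Proof.
case: cA => sA dA xH exA z [Az xz] dz; have [v Av zv] := exA z Az dz.
have [||z' [Az' dz'] /bd_divide[w bw xw]] := xH (x *: v).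
- exact: submZ.
- by rewrite linearZ /= -zv.
exists (v - z' - w); last by rewrite !raddfB /= -zv dz' (bd_cocycle bw) !subr0.
split; last by rewrite !scalerBr xw subrr.
by apply: submB => //; [exact: submB | exact: bd_sub].
Qed.

End Divisible.

Lemma exact_unkill A xs i :
  subcx A -> coregcx A xs ->
  (forall x, x \in xs -> forall u, A i u -> exists s, x ^+ s *: u = 0) ->
  exact_at (killcx A xs) i -> exact_at A i.
Proof.
elim: xs A => //= x xs IH A cA coA tA exA.
apply: (@exact_unkill1 A x) => //.
- by move=> j u Au; apply: (proj1 (coA j)).
- by move=> u; apply: tA; rewrite inE eqxx.
apply: IH => //; first exact: subcx_kill1.
  by move=> j; apply: (proj2 (coA j)).
by move=> y yxs u [Au _]; apply: tA; rewrite // inE yxs orbT.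
Qed.

(* The annihilator of the class of c is contained in a; it is a whenever a
   annihilates A, as will always be the case. *)
Definition generates A k (a : R^o -> Prop) (c : V k) :=
  [/\ A k c, d k c = 0,
      forall z, A k z -> d k z = 0 -> exists r, bd A (z - r *: c)
    & forall r, bd A (r *: c) -> a r].

(* The connecting map of [0 -> 0:_A x -> A -> A -> 0]. *)
Lemma generates_kill1 A k a (c b : V k) x :
  subcx A -> subm a -> (forall i, annihilates a (A i)) ->
  (forall i u, A i u -> exists2 v, A i v & x *: v = u) ->
  (forall i, i != k -> exact_at A i) -> generates A a c ->
  (forall r, a (x * r) -> a r) -> A k b -> x *: b = c ->
  (forall i, i != k.+1 -> exact_at (killcx A [:: x]) i) /\
  generates (killcx A [:: x]) (add1 a x) (d k b).
Proof.
move=> cA sa aA xA exA [Ac dc cgen cann] xreg Ab xb; case: (cA) => sA dA.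
have exA1 i : (i != k.+1 -> 0 < i -> exact_at A i.-1)%N.
  by case: i => // i ik _; exact: exA.
split=> [i ik|].
  have [ik'|ik'] := eqVneq i k; last first.
    by apply: (exact_kill1 cA xA); [exact: exA | exact: exA1].
  (* In degree k, z is r c up to a boundary. Since x z = 0, the class of x r c vanishes, so x r and
     then r lie in a; as a annihilates A, r c = 0. *)
  move: ik' ik => -> kk z [Az xz] dz; apply: bd_kill1 => //; first exact: exA1.
  have [r zr] := cgen z Az dz; suff ar : a r.
    by move: zr; rewrite (aA _ _ _ ar Ac) subr0.
  apply/xreg/cann; rewrite mulrC -[r * x]/(r * x) mulrC -scalerA.
  have -> : x *: (r *: c) = - (x *: (z - r *: c)).
    by rewrite scalerBr xz sub0r opprK.
  have sbd := subm_bd k cA.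
  by apply: (submN sbd); apply: submZ.
have dbx : killcx A [:: x] (d k b).
  by split; [exact: dA | rewrite -linearZ /= xb].
split=> //.
- move=> z [Az xz] dz; have k1k : k.+1 != k by rewrite neq_ltn ltnSn orbT.
  have [v Av zv] := exA _ k1k z Az dz.
  have [||r rv] := cgen (x *: v); first exact: submZ.
    by rewrite linearZ /= -zv.
  have [w bw xw] := bd_divide xA rv.
  exists r => /=; exists (v - r *: b - w).
    split; last by rewrite !scalerBr xw scalerA mulrC -scalerA xb subrr.
    by apply: submB => //; [apply: submB => //; apply: submZ | exact: bd_sub].
  by rewrite !raddfB /= -zv (bd_cocycle bw) subr0 [d k (r *: b)]linearZ.
move=> r [u [Au xu] ru].
have [||t tb] := cgen (r *: b - u).
- by apply: submB => //; apply: submZ.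
- by rewrite raddfB /= -ru [d k (r *: b)]linearZ subrr.
exists t; apply: cann.
have -> : (r - x * t) *: c = x *: (r *: b - u - t *: c).
  rewrite !scalerBr xu subr0 scalerBl -scalerA; congr (_ - _).
  by rewrite scalerA mulrC -scalerA xb.
by apply: submZ => //; exact: subm_bd.
Qed.

(** Iterates [generates_kill1] while following c' in a second complex in which powers are killed,
    with c = e c'. If b' satisfies x^(n+1) b' = c', then b = e x^n b' satisfies x b = c; so each
    step multiplies e by x^n. *)
Lemma generates_kill n xs A A' k a (c c' : V k) e :
  subcx A -> subcx A' -> subm a -> (forall i, annihilates a (A i)) ->
  coregcx A xs -> coregcx A' [seq x ^+ n.+1 | x <- xs] ->
  (forall i, i != k -> exact_at A i) -> generates A a c ->
  regular_mod a xs -> A' k c' -> d k c' = 0 -> c = e *: c' ->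
  (forall i u, A' i u -> A i (e *: u)) ->
  (forall i, i != k + size xs -> exact_at (killcx A xs) i)%N /\
  exists c1 c1' : V (k + size xs)%N,
    [/\ generates (killcx A xs) (addi a xs) c1,
        killcx A' [seq x ^+ n.+1 | x <- xs] c1', d _ c1' = 0
      & c1 = (e * \prod_(x <- xs) x ^+ n) *: c1'].
Proof.
elim: xs A A' k a c c' e => [|x xs IH] A A' k a c c' e cA cA' sa aA coA coA'
    exA cgen areg Ac' dc' cc' eA.
  rewrite addn0; split=> //; exists c, c'; split=> //.
  by rewrite big_nil mulr1.
have /= [xreg xsreg] := areg.
have [b' Ab' xb'] := proj1 (coA' k) _ Ac'.
have Ab : A k ((e * x ^+ n) *: b').
  by rewrite mulrC -scalerA; apply: submZ; [exact: (proj1 cA) | exact: eA].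
have xb : x *: ((e * x ^+ n) *: b') = c.
  by rewrite cc' -xb' !scalerA mulrCA -exprS.
have [exk genk] := generates_kill1 cA sa aA (fun i => proj1 (coA i)) exA
  cgen xreg Ab xb.
rewrite /= -addSnnS.
have [||||||||||exF [c1 [c1' [genF Ac1 dc1 c1c]]]] := IH (killcx A [:: x])
    (killcx A' [:: x ^+ n.+1]) k.+1 (add1 a x) _ (d k b') (e * x ^+ n)
    _ _ _ _ _ _ exk genk xsreg.
- exact: subcx_kill1.
- exact: subcx_kill1.
- exact: subm_add1.
- by move=> i; apply: annihilates_kill1.
- by move=> i; apply: (proj2 (coA i)).
- by move=> i; apply: (proj2 (coA' i)).
- by split; [exact: (proj2 cA') | rewrite -linearZ /= xb'].
- by rewrite dd.
- by rewrite linearZ.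
- move=> i u [A'u xu]; split.
    by rewrite mulrC -scalerA; apply: submZ; [exact: (proj1 cA) | exact: eA].
  by rewrite scalerA mulrCA -exprS -scalerA xu scaler0.
split=> //; exists c1, c1'; split=> //.
by rewrite big_cons mulrA.
Qed.

(** * Splitting of exact complexes of injectives *)

Section Splitting.
Variable L : forall i, V i -> Prop.
Arguments L : clear implicits.
Hypotheses (injV : forall i, injective_module (V i)) (cL : subcx L)
  (natL : forall i j (g : {linear V i -> V j}) u, L i u -> L j (g u)).

(* An exact complex of relatively injective modules that starts in degree 0
   splits, so that torsion boundaries lift to torsion cochains. *)
Lemma cocycles_split i : (forall j, (j <= i)%N -> exact_at L j) ->
  exists p : {linear V i -> V i},
    (forall u, L i u -> L i (p u) /\ d i (p u) = 0) /\
    (forall u, L i u -> d i u = 0 -> p u = u).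
Proof.
case: (cL) => sL dL; elim: i => [|i IH] exL.
  exists (\0 : {linear V 0 -> V 0}); split=> u Lu.
    by rewrite raddf0; split=> //; exact: subm0.
  by move=> du; rewrite (exL 0 (leqnn 0) u Lu du).
have [p [pL pid]] := IH (fun j ji => exL j (leqW ji)).
pose W w := exists2 v, L i v & w = d i v.
have sW : subm W by exact: subm_image.
have /choice[f fP] : forall w, exists v, W w -> L i v /\ w = d i v.
  move=> w; have [[v Lv wv]|nw] := pselect (W w); first by exists v.
  by exists 0.
(* Two primitives of w differ by a cocycle, which p fixes; so [s w] does not depend on the choice
   [f], and s is linear on boundaries. *)
pose s w := f w - p (f w).
have ls c u v : W u -> W v -> s (c *: u + v) = c *: s u + s v.
  move=> Wu Wv; have Wuv := proj2 sW c u v Wu Wv.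
  have [[[Lu fu] [Lv fv]] [Luv fuv]] := (fP _ Wu, fP _ Wv, fP _ Wuv).
  set q := f (c *: u + v) - (c *: f u + f v).
  have pq : p q = q.
    apply: pid; first by apply: submB => //; exact: (proj2 (sL i)).
    by rewrite raddfB /= -fuv linearP /= -fu -fv subrr.
  rewrite /s (_ : f (c *: u + v) = q + (c *: f u + f v)); last by rewrite subrK.
  rewrite raddfD /= pq opprD addrACA subrr add0r linearP /= opprD addrACA.
  by rewrite scalerBr.
have [g gE] := extend_linear sW ls (@injV i).
exists (d i \o g : {linear V i.+1 -> V i.+1}); split=> u Lu /=.
  by split; [exact/dL/natL | rewrite dd].
move=> du; have [v Lv uv] := exL i.+1 (leqnn _) u Lu du.
have Wu : W u by exists v.
have [Lf fu] := fP u Wu.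
by rewrite gE // raddfB /= (proj2 (pL _ Lf)) subr0.
Qed.

(** Take v' = v - p v for the projection p onto cocycles. If y^s kills d v, then y^s v is a cocycle,
    which p fixes, so y^s kills v'. *)
Lemma torsion_boundary ys i v : (forall j, (j <= i)%N -> exact_at L j) ->
  L i v -> torscx (fun _ _ => True) ys (d i v) ->
  exists2 v', torscx L ys v' & d i v' = d i v.
Proof.
move=> exL Lv /torsP[_ tv]; have [p [pL pid]] := cocycles_split exL.
exists (v - p v); last by rewrite raddfB /= (proj2 (pL _ Lv)) subr0.
apply/torsP; split.
  by apply: submB => //; [exact: (proj1 cL) | exact: (proj1 (pL _ Lv))].
move=> y /tv[s sv]; exists s; rewrite scalerBr -linearZ /= pid ?subrr //.
  by apply: submZ => //; exact: (proj1 cL).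
by rewrite linearZ.
Qed.

End Splitting.

(** An isomorphism from H^h(A) onto the submodule U of H, expressed on cocycles; [cl] is
    unconstrained elsewhere, so that it can be kept when A shrinks to 0:_A x. *)
Definition classifies A h (H : lmodType R) (cl : V h -> H) (U : H -> Prop) :=
  [/\ forall c z z', A h z -> d h z = 0 -> A h z' -> d h z' = 0 ->
        cl (c *: z + z') = c *: cl z + cl z',
      forall z, A h z -> d h z = 0 -> U (cl z),
      forall u, U u -> exists z, [/\ A h z, d h z = 0 & cl z = u]
    & forall z, A h z -> d h z = 0 -> (cl z = 0 <-> bd A z)].

(** Since H^(h-1)(A) = 0, the long exact sequence identifies H^h(0:_A x) with 0:_U x. *)
Lemma classifies_kill1 A h (H : lmodType R) (cl : V h -> H) U x :
  subcx A -> (forall i u, A i u -> exists2 v, A i v & x *: v = u) ->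
  (0 < h -> exact_at A h.-1)%N ->
  classifies A cl U -> classifies (killcx A [:: x]) cl (kill1 U x).
Proof.
move=> cA xA exA [cll clU clS cl0]; case: (cA) => sA dA.
have A0 : A h 0 by exact: subm0.
have d0 : d h 0 = 0 by rewrite raddf0.
have cl00 : cl 0 = 0.
  by apply/(cl0 _ A0 d0); exact: (subm0 (subm_bd h cA)).
have clZ c z : A h z -> d h z = 0 -> cl (c *: z) = c *: cl z.
  by move=> Az dz; rewrite -[c *: z]addr0 cll // cl00 addr0.
split.
- by move=> c z z' [Az _] dz [Az' _] dz'; apply: cll.
- by move=> z [Az xz] dz; split; [exact: clU | rewrite -clZ // xz].
- move=> u [Uu xu]; have [z [Az dz zu]] := clS u Uu.
  have : bd A (x *: z).
    apply/cl0; first exact: submZ.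
      by rewrite linearZ /= dz scaler0.
    by rewrite clZ // zu.
  move=> /(cocycle_lift_kill1 cA xA Az)[z' kz' zz'].
  have dz' : d h z' = 0.
    have := bd_cocycle zz'; rewrite raddfB /= dz sub0r => /eqP.
    by rewrite oppr_eq0 => /eqP.
  exists z'; split=> //.
  have Azz : A h (z - z') by apply: submB => //; case: kz'.
  have dzz : d h (z - z') = 0 by exact: bd_cocycle zz'.
  have := proj2 (cl0 _ Azz dzz) zz'.
  rewrite -[z - z']addrC -scaleN1r cll //; last by case: kz'.
  by rewrite scaleN1r zu addrC => /eqP; rewrite subr_eq0 => /eqP.
move=> z [Az xz] dz; rewrite cl0 //; split; first by move=> bz; apply: bd_kill1.
by case: (h) z {Az xz dz} => [//|j] z [v [Av _] ->]; exists v.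
Qed.

Lemma classifies_kill A h (H : lmodType R) (cl : V h -> H) U xs :
  subcx A -> coregcx A xs -> (forall i, (i < h)%N -> exact_at A i) ->
  classifies A cl U ->
  classifies (killcx A xs) cl (kill U xs) /\
  (forall i, (i < h)%N -> exact_at (killcx A xs) i).
Proof.
elim: xs A U => [//|x xs IH] A U cA coA exA clA.
apply: (IH (killcx A [:: x]) (kill1 U x)).
- exact: subcx_kill1.
- by move=> i; apply: (proj2 (coA i)).
- move=> i ih; apply: exact_kill1 => //.
  + by move=> j; apply: (proj1 (coA j)).
  + exact: exA.
  + by move=> i0; apply: exA; rewrite prednK // ltnW.
apply: classifies_kill1 => //; first by move=> i; apply: (proj1 (coA i)).
by move=> h0; apply: exA; rewrite prednK.
Qed.

(** Passing to 0:_A x can create cohomology outside degree h only in degree h + 1, namely the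
    cokernel of x on H^h, which coregularity makes zero. *)
Lemma exact_kill_above A h (H : lmodType R) (cl : V h -> H) U xs :
  subcx A -> coregcx A xs -> (forall i, i != h -> exact_at A i) ->
  classifies A cl U -> coregular U xs ->
  forall i, (h < i)%N -> exact_at (killcx A xs) i.
Proof.
elim: xs A U => [|x xs IH] A U cA coA exA clA coU i hi.
  by apply: exA; rewrite neq_ltn hi orbT.
have xA j u : A j u -> exists2 v, A j v & x *: v = u by apply: (proj1 (coA j)).
have exk j : j != h -> exact_at (killcx A [:: x]) j.
  move=> jh; have [jh1|jh1] := eqVneq j h.+1; last first.
    apply: exact_kill1 => //; first exact: exA.
    by case: j jh jh1 => // j _ jh1 _; apply: exA.
  subst j; apply: exact_kill1_top => //; last exact: exA.
  case: clA => cll clU clS cl0 z Az dz.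
  have [u Uu xu] := proj1 coU _ (clU z Az dz).
  have [z' [Az' dz' zu]] := clS u Uu; exists z' => //.
  case: (cA) => sA _.
  apply/cl0.
  - by apply: submB => //; apply: submZ.
  - by rewrite raddfB /= [d h (x *: z')]linearZ /= dz dz' scaler0 subr0.
  by rewrite addrC -scaleNr cll // zu scaleNr xu addrC subrr.
apply: (IH (killcx A [:: x]) (kill1 U x)) => //.
- exact: subcx_kill1.
- by move=> j; apply: (proj2 (coA j)).
- apply: classifies_kill1 => // h0; apply: exA.
  by case: (h) h0 => // p _; rewrite neq_ltn ltnSn.
by case: coU.
Qed.

End Complexes.

(** * Koszul complexes *)

Section Koszul.
Variable R : comNzRingType.
Implicit Types (V : lmodType R) (ys : seq R).

(* The Koszul complex of ys with values in V, all degrees together; [klt k]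
   singles out the elements whose components of degree at least k vanish. *)
Fixpoint kz ys V : lmodType R :=
  if ys is _ :: ys' then ((kz ys' V * kz ys' V)%type : lmodType R) else V.

(** The cone of multiplication by y: the second component sits one degree higher, whence the
    sign. *)
Fixpoint kdelta ys V : kz ys V -> kz ys V :=
  match ys with
  | [::] => fun _ => 0
  | y :: ys' => fun f => (kdelta f.1, y *: f.1 - kdelta f.2)
  end.

Fixpoint kmap ys V V' (g : V -> V') : kz ys V -> kz ys V' :=
  match ys with
  | [::] => g
  | y :: ys' => fun f => (kmap g f.1, kmap g f.2)
  end.

Fixpoint kall ys V (W : V -> Prop) : kz ys V -> Prop :=
  match ys with
  | [::] => W
  | y :: ys' => fun f => kall W f.1 /\ kall W f.2
  end.

Fixpoint klt ys V k : kz ys V -> Prop :=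
  match ys with
  | [::] => fun f => k = 0%N -> f = 0
  | y :: ys' => fun f => klt k f.1 /\ klt k.-1 f.2
  end.

Fixpoint ktop ys V (m : V) : kz ys V :=
  match ys with [::] => m | y :: ys' => (0, ktop ys' m) end.

Fixpoint klast ys V : kz ys V -> V :=
  match ys with [::] => id | y :: ys' => fun f => klast f.2 end.

Lemma kdelta_linear ys V c (f g : kz ys V) :
  kdelta (c *: f + g) = c *: kdelta f + kdelta g.
Proof.
elim: ys f g => [|y ys IH] /= f g; first by rewrite scaler0 addr0.
congr (_, _); rewrite ?IH // scalerDr scalerA mulrC -scalerA.
by rewrite opprD addrACA -scalerBr.
Qed.

Lemma kdelta0 ys V : kdelta (0 : kz ys V) = 0.
Proof.
by have := @kdelta_linear ys V (-1) 0 0; rewrite scaler0 addr0 scaleN1r addNr.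
Qed.

Lemma kdeltaB ys V (f g : kz ys V) : kdelta (f - g) = kdelta f - kdelta g.
Proof. by rewrite addrC -scaleN1r kdelta_linear scaleN1r addrC. Qed.

Lemma kdeltaK ys V (f : kz ys V) : kdelta (kdelta f) = 0.
Proof.
elim: ys f => [//|y ys IH] /= f; rewrite IH kdeltaB IH subr0.
rewrite -[y *: f.1]addr0 kdelta_linear kdelta0 addr0 subrr //.
Qed.

Lemma kmap_delta ys V V' (g : {linear V -> V'}) (f : kz ys V) :
  kmap g (kdelta f) = kdelta (kmap g f).
Proof.
have kmapZB zs c (f1 f2 : kz zs V) :
    kmap g (c *: f1 - f2) = c *: kmap g f1 - kmap g f2.
  elim: zs f1 f2 => [|z zs IH] f1 f2 /=; last by rewrite !IH.
  change (g (c *: (f1 : V) - (f2 : V)) = c *: g f1 - g f2).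
  by rewrite raddfB /= linearZ.
elim: ys f => [f|y ys IH f] /=; first exact: raddf0.
by rewrite -!IH; congr (_, _); exact: kmapZB.
Qed.

Lemma kmapB ys V V' (g : {linear V -> V'}) (f f' : kz ys V) :
  kmap g (f - f') = kmap g f - kmap g f'.
Proof.
elim: ys f f' => [|y ys IH] f f' /=; first exact: raddfB.
by rewrite !IH.
Qed.

Lemma subm_kall ys V (W : V -> Prop) : subm W -> subm (@kall ys V W).
Proof.
move=> sW; elim: ys => [//|y ys IH] /=; split; first by split; exact: subm0.
by move=> c f g [f1 f2] [g1 g2]; split; apply: (proj2 IH).
Qed.

Lemma subm_klt ys V k : subm (@klt ys V k).
Proof.
elim: ys k => [|y ys IH] k /=.
  by split=> // c f g fk gk k0; rewrite fk // gk // scaler0 addr0.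
split; first by split; apply: subm0.
by move=> c f g [f1 f2] [g1 g2]; split; apply: (proj2 (IH _)).
Qed.

Lemma kall_sub ys V (W W' : V -> Prop) (f : kz ys V) :
  (forall u, W u -> W' u) -> kall W f -> kall W' f.
Proof.
move=> WW'; elim: ys f => [|y ys IH] f /=; first exact: WW'.
by case=> /IH f1 /IH f2.
Qed.

Lemma kall_delta ys V (W : V -> Prop) (f : kz ys V) :
  subm W -> kall W f -> kall W (kdelta f).
Proof.
move=> sW; elim: ys f => [|y ys IH] f /=; first by move=> _; exact: subm0.
move=> [f1 f2]; split; first exact: IH.
have sk := subm_kall ys sW.
by apply: submB => //; [apply: submZ | apply: IH].
Qed.

Lemma kall_map ys V V' (g : V -> V') (W : V -> Prop) (W' : V' -> Prop)
    (f : kz ys V) :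
  (forall u, W u -> W' (g u)) -> kall W f -> kall W' (kmap g f).
Proof.
by move=> WW'; elim: ys f => [|y ys IH] f /=; [exact: WW' | case=> /IH + /IH].
Qed.

Lemma klt_map ys V V' (g : {linear V -> V'}) k (f : kz ys V) :
  klt k f -> klt k (kmap g f).
Proof.
elim: ys k f => [|y ys IH] k f /=; last by case=> /IH + /IH.
by move=> fk /fk ->; rewrite raddf0.
Qed.

Lemma klt_size ys V (f : kz ys V) : klt (size ys).+1 f.
Proof.
suff H k : (size ys < k)%N -> klt k f by exact: H.
elim: ys k f => [|y ys IH] [|k] f //= kys.
by split; apply: IH => //; exact: ltnW.
Qed.

Lemma klt0 ys V (f : kz ys V) : klt 0 f -> f = 0.
Proof.
elim: ys f => [|y ys IH] /=; first by move=> f ->.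
by case=> f1 f2 /= [/IH -> /IH ->].
Qed.

Lemma kall_and ys V (W W' : V -> Prop) (f : kz ys V) :
  kall W f -> kall W' f -> kall (fun u => W u /\ W' u) f.
Proof. by elim: ys f => //= y ys IH f [f1 f2] [g1 g2]; split; apply: IH. Qed.

Lemma kall_preim ys V V' (g : V -> V') (W : V' -> Prop) (f : kz ys V) :
  kall W (kmap g f) -> kall (fun u => W (g u)) f.
Proof. by elim: ys f => //= y ys IH f [f1 f2]; split; apply: IH. Qed.

Lemma klift ys V V' (g : {linear V -> V'}) (W : V -> Prop) (W' S : V' -> Prop)
    k (f : kz ys V') :
  subm W -> subm S -> (forall u, W' u -> exists2 v, W v & S (g v - u)) ->
  klt k f -> kall W' f ->
  exists f', [/\ klt k f', kall W f' & kall S (kmap g f' - f)].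
Proof.
move=> sW sS WW'; elim: ys k f => [|y ys IH] k f /=.
  (* For k = 0 the lift has to be 0, and so is f. *)
  move=> fk /WW'[v Wv Sv]; have [k0|k0] := pselect (k = 0%N).
    exists 0; split=> //; first exact: subm0.
    by rewrite raddf0 (fk k0) subr0; exact: subm0.
  by exists v.
move=> [/IH H1 /IH H2] [/H1[a [a1 a2 a3]] /H2[b [b1 b2 b3]]].
by exists (a, b).
Qed.

(** Exactness of the Koszul complex of [ys] on W/S, without forming the quotient: a cocycle with no
    component above degree k bounds a cochain with none above degree k - 1. *)
Definition relex ys V (W S : V -> Prop) :=
  forall k (f : kz ys V), klt k.+1 f -> kall W f -> kall S (kdelta f) ->
  exists g, [/\ klt k g, kall W g & kall S (f - kdelta g)].

(** Exactness for W/S' and S'/S gives exactness for W/S. *)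
Lemma relex_trans ys V (W S' S : V -> Prop) : subm W ->
  (forall u, S u -> S' u) -> (forall u, S' u -> W u) ->
  (forall k (f : kz ys V), klt k f -> klt k.+1 (kdelta f)) ->
  relex ys W S' -> relex ys S' S -> relex ys W S.
Proof.
move=> sW SS' S'W kltd relW relS k f fk fW fS.
have [g [gk gW fg]] := relW k f fk fW (kall_sub SS' fS).
have [||g' [g'k g'W fg']] := relS k (f - kdelta g) _ fg.
- by apply: (submB (subm_klt _ _ _)) => //; exact: kltd.
- by rewrite kdeltaB kdeltaK subr0.
have sk := subm_kall ys sW; have slt := subm_klt ys V k.
exists (g + g'); split.
- exact: submD.
- by apply: submD => //; exact: kall_sub g'W.
by rewrite -[g + g']/(g + g') -[g]scale1r kdelta_linear scale1r opprD addrA.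
Qed.

Lemma klt_delta ys V k (f : kz ys V) : klt k f -> klt k.+1 (kdelta f).
Proof.
elim: ys k f => [//|y ys IH] k f /= [f1 f2]; split; first exact: IH.
have slt := subm_klt ys V k; apply: submB => //; first exact: submZ.
case: k f1 f2 slt => [|k] f1 f2 slt; last exact: IH.
by rewrite (klt0 f2) kdelta0; exact: subm0.
Qed.

(** The cone of an endomorphism of an exact complex is exact. *)
Lemma relex_cons y ys V (W S : V -> Prop) : subm W -> subm S ->
  relex ys W S -> relex (y :: ys) W S.
Proof.
move=> sW sS rel k [a b] /= [ak bk] [aW bW] [da db].
have skW := subm_kall ys sW; have skS := subm_kall ys sS.
have [c [ck cW ac]] := rel k a ak aW da.
(* For k = 0 the bounds force b and c to vanish, and 0 is the required primitive. *)
case: k ak bk ck => [|k] ak bk ck.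
  exists 0; split; try by split; exact: subm0.
    by split; apply: subm0; exact: subm_klt.
  rewrite (klt0 bk) kdelta0 subr0 scaler0 !subr0.
  by move: ac; rewrite (klt0 ck) kdelta0 subr0; split=> //; exact: subm0.
have [|||e [ek eW ce]] := rel k (y *: c - b) _ _.
- have slt := subm_klt ys V k.+1.
  by apply: submB => //; exact: submZ.
- by apply: submB => //; exact: submZ.
- have -> : kdelta (y *: c - b) = (y *: a - kdelta b) - y *: (a - kdelta c).
    rewrite kdeltaB -[y *: c]addr0 kdelta_linear kdelta0 addr0 scalerBr.
    by rewrite opprB [RHS]addrC addrA subrK.
  by apply: submB => //; exact: submZ.
exists (c, e); split=> //=; split=> //.
by rewrite -opprB; apply: submN => //; rewrite addrAC.
Qed.

(** The cone of an isomorphism is exact: solve y c = b modulo S; then y (a - delta c) lies in S,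
    hence so does a - delta c. *)
Lemma relex_bijective y ys V (W S : V -> Prop) : subm W -> subm S ->
  (forall u, W u -> exists2 v, W v & S (y *: v - u)) ->
  (forall u, W u -> S (y *: u) -> S u) ->
  relex (y :: ys) W S.
Proof.
move=> sW sS ysurj yinj k [a b] /= [ak bk] [aW bW] [da db].
have skW := subm_kall ys sW; have skS := subm_kall ys sS.
have kE zs (c : kz zs V) :
    kmap (y \*: idfun : {linear V -> V}) c = y *: c.
  by elim: zs c => [//|z zs IH] /= c; rewrite !IH.
have [c [ck cW]] :=
  @klift ys V V (y \*: idfun : {linear V -> V}) W W S k b sW sS ysurj bk bW.
rewrite kE => cb.
have kyinj (f : kz ys V) : kall W f -> kall S (y *: f) -> kall S f.
  elim: (ys) f => [|z zs IH] f /=; first exact: yinj.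
  by case=> Wf1 Wf2 [Sf1 Sf2]; split; apply: IH.
exists (c, 0); split=> /=.
- by split=> //; exact: (subm0 (subm_klt _ _ _)).
- by split=> //; exact: subm0.
split; last by rewrite kdelta0 subr0 -opprB; exact: submN.
apply: kyinj; first by apply: submB => //; exact: kall_delta.
have -> : y *: (a - kdelta c) = (y *: a - kdelta b) - kdelta (y *: c - b).
  rewrite kdeltaB -[y *: c]addr0 kdelta_linear kdelta0 addr0 scalerBr.
  by rewrite opprB addrA subrK.
by apply: submB => //; exact: kall_delta.
Qed.

(** The first y is bijective on W modulo its y-torsion, which settles that quotient; the y-torsion
    of W is again injective in Baer's sense, so induction handles the rest. *)
Lemma relex_tors (noethR : noetherian R) ys V a (W : V -> Prop) :
  subm a -> subm W -> annihilates a W -> baer a W -> relex ys W (tors W ys).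
Proof.
move=> sa; elim: ys W => [|y ys IH] W sW aW bW.
  move=> k f fk fW df; exists 0; split; first exact: (subm0 (subm_klt _ _ _)).
    exact: subm0.
  by rewrite kdelta0 subr0.
have st := subm_tors1 y sW.
apply: (relex_trans (S' := tors1 W y)) => //.
- by move=> u /(@torsP _ _ (tors1 W y))[].
- by move=> u [].
- exact: klt_delta.
- apply: relex_bijective => //.
    by move=> u Wu; apply: baer_divide_tors aW bW Wu.
  move=> u Wu [_ [s sy]]; split=> //; exists s.+1.
  by rewrite exprSr -scalerA.
apply: relex_cons => //; first exact: subm_tors.
apply: IH => //; last exact: baer_tors1.
by apply: annihilates_sub aW => u [].
Qed.

(** * The double complex of Koszul cochains with values in L/S *)

Section Zigzag.
Variables (V : nat -> lmodType R) (d : forall i, {linear V i -> V i.+1}).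
Hypothesis dd : forall i u, d i.+1 (d i u) = 0.
Variables (L S : forall i, V i -> Prop) (ys : seq R) (h : nat).
Arguments L : clear implicits.
Arguments S : clear implicits.
Hypotheses (cL : subcx d L) (cS : subcx d S).
Hypothesis rel : forall i, relex ys (L i) (S i).
Hypothesis relexact : forall i w, (h <= i)%N -> L i.+1 w -> S i.+2 (d i.+1 w) ->
  exists2 v, L i v & S i.+1 (w - d i v).

Lemma kzigzag k i (q : kz ys (V i)) : (h <= i)%N -> klt k q -> kall (L i) q ->
  kall (S i.+1) (kdelta (kmap (d i) q)) ->
  exists q', [/\ kall (L i) q', kall (S i.+1) (kmap (d i) q')
               & kall (S i) (kdelta q' - kdelta q)].
Proof.
have skL j := subm_kall ys (proj1 cL j).
have skS j := subm_kall ys (proj1 cS j).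
elim: k i q => [|k IH] i q hi qk qL dq.
  rewrite (klt0 qk).
  exists 0; split; first exact: subm0.
    by rewrite -(subrr 0) kmapB subrr; exact: subm0.
  by rewrite subrr; exact: subm0.
have dqL : kall (L i.+1) (kmap (d i) q) by exact: kall_map (proj2 cL i) qL.
have [q1 [q1k q1L dq1]] := rel (klt_map (d i) qk) dqL dq.
have kdd (f : kz ys (V i)) : kmap (d i.+1) (kmap (d i) f) = 0.
  by elim: (ys) f => [|z zs IHz] f /=; [exact: dd | rewrite !IHz].
have [|q2 [q2L dq2 q12]] := IH i.+1 q1 (leqW hi) q1k q1L.
  rewrite -kmap_delta -[X in kmap _ X](subKr (kmap (d i) q)) kmapB kdd sub0r.
  by apply: submN => //; exact: kall_map (proj2 cS i.+1) dq1.
have [|r [_ rL q2r]] := klift (g := d i) (proj1 cL i) (proj1 cS i.+1) _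
    (klt_size q2) (kall_and q2L (kall_preim dq2)).
  move=> u [Lu /(relexact hi Lu)[v Lv Sv]]; exists v => //.
  by rewrite -opprB; apply: submN => //; exact: (proj1 cS).
exists (q - kdelta r); split.
- by apply: submB => //; apply: kall_delta => //; exact: (proj1 cL).
- rewrite kmapB kmap_delta.
  have -> : kmap (d i) q - kdelta (kmap (d i) r) =
      (kmap (d i) q - kdelta q1) - (kdelta q2 - kdelta q1)
      - kdelta (kmap (d i) r - q2).
    by rewrite kdeltaB !opprB !subrKA.
  apply: submB => //; first exact: submB.
  by apply: kall_delta => //; exact: (proj1 cS).
by rewrite kdeltaB kdeltaK subr0 subrr; exact: subm0.
Qed.

(** Placed in top Koszul degree, m is delta q modulo S, and the zigzag makes q a d-cocycle modulo S.
    The top component of delta q is then a signed sum of terms y z with z a cocycle modulo S. *)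
Lemma kgenerate (T : V h -> Prop) m : subm T -> (forall u, S h u -> T u) ->
  (forall y z, y \in ys -> L h z -> S h.+1 (d h z) -> T (y *: z)) ->
  L h m -> d h m = 0 -> T m.
Proof.
move=> sT ST yT Lm dm.
have topL zs : kall (L h) (ktop zs m).
  elim: zs => [//|z zs IH] /=; split=> //.
  exact: (subm0 (subm_kall _ (proj1 cL h))).
have toplt zs : klt (size zs).+1 (ktop zs m).
  by elim: zs => [//|z zs IH] /=; split=> //; exact: (subm0 (subm_klt _ _ _)).
have dtop zs : kdelta (ktop zs m) = 0.
  by elim: zs => [//|z zs IH] /=; rewrite IH kdelta0 scaler0 subr0.
have mtop zs : kmap (d h) (ktop zs m) = 0.
  elim: zs => [//|z zs IH] /=; rewrite IH; congr (_, _).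
  by rewrite -(subrr 0) kmapB subrr.
have lastS zs (f : kz zs (V h)) : kall (S h) f -> S h (klast f).
  by elim: zs f => [//|z zs IH] f /= [_ /IH].
have [|q [qk qL qtop]] := rel (toplt ys) (topL ys).
  by rewrite dtop; exact: (subm0 (subm_kall _ (proj1 cS h))).
have [|q' [q'L dq' qq']] := kzigzag (leqnn h) qk qL.
  rewrite -kmap_delta -[kdelta q](subKr (ktop ys m)) kmapB mtop sub0r.
  apply: submN; first exact: (subm_kall _ (proj1 cS _)).
  exact: kall_map (proj2 cS h) qtop.
have lastB zs (f g : kz zs (V h)) : klast (f - g) = klast f - klast g.
  by elim: zs f g => //= z zs IH f g; rewrite IH.
have lasttop zs : klast (ktop zs m) = m by elim: zs.
have {q qk qL qtop qq'} Sm : S h (m - klast (kdelta q')).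
  rewrite -[X in X - _](lasttop ys) -lastB; apply: lastS.
  have skS := subm_kall ys (proj1 cS h).
  rewrite -(subrKA (kdelta q)) -[kdelta q - _]opprB.
  exact: submB.
rewrite -[m](subrK (klast (kdelta q'))); apply: submD => //; first exact: ST.
elim: (ys) q' q'L dq' yT {Sm} => [|y zs IH] /= q'.
  by move=> _ _ _; exact: subm0.
have lastZ xs c (f : kz xs (V h)) : klast (c *: f) = c *: klast f.
  by elim: xs f => //= x xs IHx f; rewrite IHx.
move=> [qL1 qL2] [dq1 dq2] yT; rewrite lastB lastZ; apply: submB => //.
  apply: yT; first by rewrite inE eqxx.
    by elim: (zs) (q'.1) qL1 => [//|z xs IHx] f /= [_ /IHx].
  by elim: (zs) (q'.1) dq1 => [//|z xs IHx] f /= [_ /IHx].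
by apply: IH => // z w zzs; apply: yT; rewrite inE zzs orbT.
Qed.

End Zigzag.

End Koszul.

(** * Generators, exponents and Matlis duality *)

Section Ideals.
Variable R : comNzRingType.
Implicit Types (V : lmodType R).

(** A pigeonhole argument: expand one factor b as a combination of the y_j and let y_j act on u,
    which lowers s_j by one. If s_j is already 0, then u itself lies in S. *)
Lemma gen_powers V (S : V -> Prop) n (y : 'I_n -> R) : subm S ->
  forall t (s : 'I_n -> nat) u (b : 'I_t -> R),
    (forall j, S (y j ^+ s j *: u)) -> (forall i, b i \in gen R^o y) ->
    (\sum_j s j < t)%N -> S ((\prod_i b i) *: u).
Proof.
move=> sS; elim=> [//|t IH] s u b su bI st.
rewrite big_ord_recl; have /asboolP[c ->] := bI ord0.
rewrite mulrC mulr_sumr scaler_suml; apply: subm_sum => // j _.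
set p := \prod_(i < t) _.
have -> : (p * (y j *: c j)) *: u = c j *: (p *: (y j *: u)).
  by rewrite !scalerA; congr (_ *: u); rewrite [_ *: _]mulrC mulrCA mulrA.
apply: submZ => //.
case sj: (s j) => [|q].
  by have := su j; rewrite sj scale1r => Su; apply: submZ => //; apply: submZ.
apply: (IH (fun k => if k == j then q else s k)) => // [k|].
  case: eqP => [->|_]; first by rewrite scalerA -exprSr -sj.
  by rewrite scalerA mulrC -scalerA; apply: submZ.
move: st; rewrite (bigD1 j) //= sj addSn ltnS; apply: leq_trans.
rewrite ltnS (bigD1 j) //= eqxx leq_add2l leq_sum // => k /negPf kj.
by rewrite kj.
Qed.

Lemma mem_gen n (y : 'I_n -> R) j : y j \in gen R^o y.
Proof.
apply/asboolP; exists (fun i => (i == j)%:R).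
rewrite (bigD1 j) //= big1 => [|i /negPf ->]; last exact: scaler0.
by rewrite eqxx addr0 [_ *: _]mulr1.
Qed.

Lemma ideal_pow_powers V (S : V -> Prop) (I : ideal R) n (y : 'I_n -> R) u :
  subm S -> I =i gen R^o y -> (forall j, exists s, S (y j ^+ s *: u)) ->
  exists t, forall a, a \in ideal_pow I t -> S (a *: u).
Proof.
move=> sS Iy /choice[s su]; exists (\sum_j s j).+1 => a.
move=> /asboolP[k [c [b [bI ->]]]]; rewrite scaler_suml.
apply: subm_sum => // i _; rewrite -scalerA; apply: submZ => //.
by apply: (@gen_powers _ _ _ y sS _ s) => // j; rewrite -Iy.
Qed.

Lemma mem_ideal_pow (I : ideal R) a s : a \in I -> a ^+ s \in ideal_pow I s.
Proof.
move=> aI; apply/asboolP; exists 1%N, (fun=> 1), (fun _ _ => a); split=> //.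
by rewrite big_ord1 mul1r prodr_const card_ord.
Qed.

Lemma codom_ordS (T : Type) n (y : 'I_n.+1 -> T) :
  codom y = y ord0 :: codom (y \o lift ord0).
Proof. by rewrite /codom /image_mem enum_ordSl /= -map_comp. Qed.

Lemma addiP (a : R^o -> Prop) n (y : 'I_n -> R) r : subm a ->
  addi a (codom y) r <-> exists v : 'I_n -> R, a (r - \sum_i y i * v i).
Proof.
elim: n a y r => [|n IH] a y r sa.
  have -> : codom y = [::] by apply: size0nil; rewrite size_codom card_ord.
  by split=> [ar|[v]]; [exists (fun=> 0)|]; rewrite big_ord0 subr0.
rewrite codom_ordS /= IH; last exact: subm_add1.
split=> [[v [t vt]]|[v av]].
  exists (fun i => oapp v t (unlift ord0 i)).
  rewrite big_ord_recl unlift_none /=.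
  rewrite opprD [X in a (r + X)]addrC addrA.
  by under eq_bigr do rewrite liftK.
exists (v \o lift ord0), (v ord0); move: av.
by rewrite big_ord_recl opprD [X in a (r + X)]addrC addrA.
Qed.

Lemma addi0P n (y : 'I_n -> R) r :
  addi (fun r => r = 0) (codom y) r <-> r \in gen R^o y.
Proof.
rewrite addiP; last exact: subm_zero.
split=> [[v /eqP]|/asboolP[v ->]]; last by exists v; exact: subrr.
by rewrite subr_eq0 => /eqP ->; apply/asboolP; exists v.
Qed.

Lemma nth_codom (T : Type) (x0 : T) n (y : 'I_n -> T) (i : 'I_n) :
  nth x0 (codom y) i = y i.
Proof.
by rewrite /codom /image_mem (nth_map i) ?nth_ord_enum // size_enum_ord.
Qed.

Lemma take_codom n (y : 'I_n -> R) (i : 'I_n) :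
  take i (codom y) = codom (@prefix_seq _ _ y i).
Proof.
have sz : size (codom y) = n by rewrite size_codom card_ord.
apply: (@eq_from_nth _ 0) => [|k].
  by rewrite size_take sz ltn_ord size_codom card_ord.
rewrite size_take sz ltn_ord => ki; rewrite nth_take //.
have kn := ltn_trans ki (ltn_ord i).
rewrite (nth_codom 0 y (Ordinal kn)) (nth_codom 0 _ (Ordinal ki)).
by congr (y _); apply: val_inj.
Qed.

Lemma regular_modP (a : R^o -> Prop) xs :
  (forall k, (k < size xs)%N -> forall r, addi a (take k xs) (xs`_k * r) ->
     addi a (take k xs) r) -> regular_mod a xs.
Proof.
elim: xs a => //= x xs IH a H; split; first exact: (H 0%N).
by apply: IH => k; exact: (H k.+1).
Qed.

Lemma coregularP V (A : V -> Prop) xs :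
  coregular A xs <-> forall k, (k < size xs)%N -> forall u,
    kill A (take k xs) u -> exists2 v, kill A (take k xs) v & xs`_k *: v = u.
Proof.
elim: xs A => //= x xs IH A; rewrite IH; split=> [[H H'] [|k]|H].
- by rewrite take0.
- exact: H'.
by split=> [|k]; [exact: (H 0%N) | exact: (H k.+1)].
Qed.

Lemma regular_seq_mod n (x : 'I_n -> R) :
  regular_seq x R^o -> regular_mod (fun r => r = 0) (codom x).
Proof.
move=> [xinj _]; apply: regular_modP => k.
rewrite size_codom card_ord => kn r.
have := take_codom x (Ordinal kn) => /= ->.
rewrite (nth_codom 0 x (Ordinal kn)) !addi0P => xr.
rewrite -quot_pr_eq0; apply/eqP; apply: (xinj (Ordinal kn)).
by rewrite scaler0 -linearZ; apply/eqP; rewrite quot_pr_eq0.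
Qed.

Lemma kill_take_codom V (A : V -> Prop) n (x : 'I_n -> R) k u :
  kill A (take k (codom x)) u <->
  A u /\ forall i : 'I_n, (i < k)%N -> x i *: u = 0.
Proof.
rewrite killP; have sz : size (codom x) = n by rewrite size_codom card_ord.
split=> -[Au H]; split=> //; [move=> i ik|move=> y].
  apply: H; rewrite -(nth_codom 0 x i) -(nth_take 0 ik) mem_nth //.
  by rewrite size_take sz; case: ifP.
move=> /(nthP 0)[j jk <-]; move: jk.
rewrite size_take_min sz leq_min => /andP[jk jn].
by rewrite nth_take // (nth_codom 0 x (Ordinal jn)) H.
Qed.

Lemma kill_codom V (A : V -> Prop) n (x : 'I_n -> R) u :
  kill A (codom x) u <-> A u /\ forall i, x i *: u = 0.
Proof.
have := kill_take_codom A x n u.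
rewrite take_oversize ?size_codom ?card_ord // => ->.
by split=> -[Au H]; split=> // i; exact: H.
Qed.

(** * From lifting along powers to coregularity *)

Section Lifts.
Variables (H : lmodType R) (n : nat) (x : 'I_n -> R).

Definition lifts := forall l (u : H), (forall i, x i *: u = 0) ->
  exists2 v, forall i, x i ^+ l.+1 *: v = 0 & (\prod_i x i) ^+ l *: v = u.

(** Extends [lifts] to elements killed by unequal powers, by induction on the sum of the a_i. For
    a_i > 0, lift x_i u first, with l + 1 in place of l, and then the remainder of u, which x_i
    kills. *)
Lemma lifts_exponents (a : 'I_n -> nat) (u : H) l : lifts ->
  (forall i, x i ^+ (a i).+1 *: u = 0) ->
  exists2 v, forall i, x i ^+ ((a i).+1 + l) *: v = 0
    & (\prod_i x i) ^+ l *: v = u.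
Proof.
move=> lif; have [N aN] := ubnP (\sum_i a i).
elim: N a u l aN => // N IH a u l; rewrite ltnS => aN au.
have [a0|] := pselect (forall i, a i = 0%N).
  have [|v xv Xv] := lif l u; first by move=> i; have := au i; rewrite a0.
  by exists v => // i; rewrite a0 add1n.
move=> /existsNP[i ai]; case ai': (a i) ai => [//|b] _.
pose P := \prod_(j | j != i) x j.
have XP : \prod_j x j = x i * P by rewrite (bigD1 i).
have xP j : j != i -> exists q, P = x j * q.
  move=> ji; exists (\prod_(k | (k != i) && (k != j)) x k).
  by rewrite /P (bigD1 j).
have sumlt c : (c <= b)%N -> (\sum_j (if j == i then c else a j) < N)%N.
  move=> cb; apply: leq_trans aN; rewrite (bigD1 i) //= eqxx.
  rewrite [X in (_ < X)%N](bigD1 i) //= ai' addSn ltnS leq_add //.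
  by rewrite leq_sum // => j /negPf ->.
have killM j p q (v : H) : x j ^+ p *: v = 0 -> x j ^+ (p + q) *: v = 0.
  by move=> pv; apply: scale_pow_le pv; exact: leq_addr.
have [|v' xv' Xv'] := IH _ (x i *: u) l.+1 (sumlt b (leqnn b)).
  move=> j; case: eqP => [->|_].
    by rewrite scalerA -exprSr -ai' au.
  by rewrite scalerA mulrC -scalerA au scaler0.
(* P is divisible by x_j, so P^(l+1) absorbs l + 1 factors x_j. *)
have killP' j p (w : H) : j != i ->
    x j ^+ (p + l.+1) *: w = 0 -> x j ^+ p *: (P ^+ l.+1 *: w) = 0.
  move=> ji pw; have [q ->] := xP j ji.
  by rewrite exprMn scalerA mulrA -exprD mulrC -scalerA pw scaler0.
(* As x_i P = X, subtracting this term turns x_i u into x_i u - X^(l+1) v' = 0. *)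
pose u' := u - x i ^+ l *: (P ^+ l.+1 *: v').
have xu' : x i *: u' = 0.
  rewrite scalerBr !scalerA mulrA -exprS -exprMn -XP.
  by rewrite Xv' subrr.
have [|v'' xv'' Xv''] := IH (fun j => if j == i then 0%N else a j) u' l
    (sumlt 0%N (leq0n b)).
  move=> j; case: eqP => [->|/eqP ji]; first by rewrite expr1.
  rewrite scalerBr au sub0r scalerA mulrC -scalerA killP' ?scaler0 ?oppr0 //.
  have := xv' j; rewrite (negPf ji) scalerA mulrC -scalerA => ->.
  exact: scaler0.
exists (P *: v' + v''); last first.
  rewrite scalerDr Xv'' XP exprMn -!scalerA [P ^+ l *: _]scalerA -exprSr.
  by rewrite addrC subrK.
move=> j; rewrite scalerDr; have [->|ji] := eqVneq j i.
  have := xv' i; rewrite eqxx addnS -addSn -ai' => e.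
  rewrite scalerA mulrC -scalerA e scaler0 add0r.
  have := xv'' i; rewrite eqxx => /(scale_pow_le _) -> //.
  by rewrite leq_add2r.
have [q Pq] := xP j ji.
have := xv' j; have := xv'' j; rewrite (negPf ji) => -> e.
by rewrite addr0 scalerA Pq mulrA -exprSr mulrC -scalerA -addnS e scaler0.
Qed.

(** Write u = X v with x_j^2 v = 0 for j < k. The product of all x_j with j different from k,
    applied to v, divides u by x_k and is killed by each x_j with j < k. *)
Lemma coregular_lifts : (forall u : H, forall i, exists s, x i ^+ s *: u = 0) ->
  lifts -> coregular (fun _ : H => True) (codom x).
Proof.
move=> tH lif; apply/coregularP => k.
rewrite size_codom card_ord => kn u /kill_take_codom[_ xu].
have /choice[s su] := tH u.
pose a (i : 'I_n) := if (i < k)%N then 0%N else s i.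
have [|v xv Xv] := @lifts_exponents a u 1 lif.
  move=> i; rewrite /a; case: ifP => [ik|_]; first by rewrite expr1 xu.
  exact: scale_pow_le (leqnSn _) (su i).
pose i := Ordinal kn; exists ((\prod_(j | j != i) x j) *: v); last first.
  by rewrite (nth_codom 0 x i) scalerA -Xv expr1 [in RHS](bigD1 i).
apply/kill_take_codom; split=> // j jk; have := xv j; rewrite /a jk => e.
rewrite (bigD1 j) /=; last by rewrite neq_ltn jk.
by rewrite scalerA mulrA mulrC -expr2 -scalerA e scaler0.
Qed.

End Lifts.

(** * Matlis duality *)

Section Duality.
Variables (E H : lmodType R).
Hypothesis injE : injective_module E.

Definition ffun_single n (i : 'I_n) (u : H) : {ffun 'I_n -> H} :=
  [ffun j => if j == i then u else 0].

Lemma ffun_single_is_linear n (i : 'I_n) : linear (ffun_single i).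
Proof.
move=> a u v; apply/ffunP => j; rewrite !ffunE.
by case: ifP => _; rewrite ?scaler0 ?addr0.
Qed.
HB.instance Definition _ n (i : 'I_n) := GRing.isLinear.Build R H
  {ffun 'I_n -> H} _ (ffun_single i) (ffun_single_is_linear i).

(** If phi vanishes on 0:_H y, it factors through the image of H -> H^n, u |-> (y_i u). Injectivity
    of E extends it to H^n, and the components of the extension are the coefficients. *)
Lemma in_gen_Hom n (y : 'I_n -> R) (phi : matlis_dual E H) :
  phi \in gen (matlis_dual E H) y <->
  forall u : H, (forall i, y i *: u = 0) -> (phi : H -> E) u = 0.
Proof.
split=> [/asboolP[v ->] u yu|phi0].
  have ev (r : seq 'I_n) :
      ((\sum_(i <- r) y i *: v i : matlis_dual E H) : H -> E) u
      = \sum_(i <- r) y i *: (v i : H -> E) u.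
    by elim: r => [|i r IH]; rewrite ?big_nil // !big_cons -IH.
  rewrite ev big1 // => i _.
  by rewrite -linearZ /= yu raddf0.
pose W (w : {ffun 'I_n -> H}) := exists u, w = [ffun i => y i *: u].
have W_lin a u v : [ffun i => y i *: (a *: u + v)]
    = a *: [ffun i => y i *: u] + [ffun i => y i *: v] :> {ffun 'I_n -> H}.
  by apply/ffunP => i; rewrite !ffunE scalerDr !scalerA mulrC.
have sW : subm W.
  split=> [|a _ _ [u ->] [v ->]].
    by exists 0; apply/ffunP => i; rewrite !ffunE scaler0.
  by exists (a *: u + v); rewrite W_lin.
have /choice[f fP] : forall w, exists u, W w -> w = [ffun i => y i *: u].
  move=> w; have [[u wu]|nw] := pselect (W w); first by exists u.
  by exists 0.
have fE w u : w = [ffun i => y i *: u] ->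
    (phi : H -> E) (f w) = (phi : H -> E) u.
  move=> wu; apply/eqP; rewrite -subr_eq0 -raddfB; apply/eqP/phi0 => i.
  have /ffunP/(_ i) : w = [ffun i => y i *: f w] by apply: fP; exists u.
  by rewrite {1}wu !ffunE scalerBr => ->; rewrite subrr.
have lf a u v : W u -> W v ->
    (phi : H -> E) (f (a *: u + v))
    = a *: (phi : H -> E) (f u) + (phi : H -> E) (f v).
  move=> /fP uf /fP vf; rewrite -linearP; apply: fE.
  by rewrite W_lin -uf -vf.
have [g gE] := extend_linear sW lf injE.
apply/asboolP.
exists (fun i => (g \o ffun_single i : {linear H -> E}) : matlis_dual E H).
apply: Hom_ext => u.
have ev (r : seq 'I_n) (v : 'I_n -> matlis_dual E H) :
    ((\sum_(i <- r) y i *: v i : matlis_dual E H) : H -> E) u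
    = \sum_(i <- r) y i *: (v i : H -> E) u.
  by elim: r => [|i r IH]; rewrite ?big_nil // !big_cons -IH.
rewrite ev /=.
have Wu : W [ffun i => y i *: u] by exists u.
rewrite -(fE _ u erefl) -gE //.
under eq_bigr do rewrite -!linearZ.
rewrite -(raddf_sum g); congr (g _); apply/ffunP => j; rewrite ffunE sum_ffunE.
rewrite (bigD1 j) //= !ffunE eqxx big1 ?addr0 // => i ij.
by rewrite !ffunE eq_sym (negPf ij).
Qed.

(** On A + Ru send a + r u to the class of r in R/m inside E. This is well defined because the r
    with r u in A form a proper ideal, hence lie in m. *)
Lemma cogenerator (m : ideal R) (e : {linear quotmod m -> E})
    (A : H -> Prop) u :
  local_ring m -> injective e -> subm A -> ~ A u ->
  exists phi : {linear H -> E}, (forall v, A v -> phi v = 0) /\ phi u <> 0.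
Proof.
move=> loc einj sA Au.
pose J (r : R^o) := A (r *: u).
have sJ : subm J.
  split=> [|a r s Jr Js]; first by rewrite /J scale0r; exact: subm0.
  by rewrite /J scalerDl -scalerA; exact: (proj2 sA).
have J1 : ~ J 1 by rewrite /J scale1r.
have Jm := proper_sub_maximal loc sJ J1.
pose W w := exists r, A (w - r *: u).
have sW : subm W.
  split=> [|a v w [r vr] [s ws]].
    by exists 0; rewrite scale0r subr0; exact: subm0.
  exists (a * r + s); rewrite scalerDl -scalerA opprD addrACA -scalerBr.
  exact: (proj2 sA).
have /choice[f fP] : forall w, exists r, W w -> A (w - r *: u).
  move=> w; have [[r wr]|nw] := pselect (W w); first by exists r.
  by exists 0.
have fE w r : A (w - r *: u) ->
    e (quot_pr m (f w : R^o)) = e (quot_pr m (r : R^o)).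
  move=> wr; congr (e _); apply/eqP.
  rewrite -subr_eq0 -(raddfB (quot_pr m)) quot_pr_eq0.
  apply: Jm; rewrite /J scalerBl.
  have -> : f w *: u - r *: u = (w - r *: u) - (w - f w *: u).
    by rewrite opprB [RHS]addrC addrA subrK.
  by apply: submB => //; apply: fP; exists r.
have lf a v w : W v -> W w -> e (quot_pr m (f (a *: v + w) : R^o))
    = a *: e (quot_pr m (f v : R^o)) + e (quot_pr m (f w : R^o)).
  move=> /fP vf /fP wf; rewrite -!linearP; apply: fE.
  rewrite scalerDl -scalerA opprD addrACA -scalerBr.
  exact: (proj2 sA).
have [g gE] := extend_linear sW lf injE.
exists g; split=> [v Av|gu].
  have vA : A (v - 0 *: u) by rewrite scale0r subr0.
  by rewrite gE; [rewrite (fE _ _ vA) !raddf0 | exists 0].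
have uA : A (u - 1 *: u) by rewrite scale1r subrr; exact: subm0.
have := gE u (ex_intro _ 1 uA).
rewrite gu (fE _ _ uA) -(raddf0 e) => /einj/esym/eqP.
rewrite quot_pr_eq0 => m1; case: loc => [[+ _] _].
by rewrite /proper_idl m1.
Qed.

End Duality.

End Ideals.

(** * The top local cohomology module *)

Section Main.
Variables (R : comNzRingType) (m : ideal R).
Hypotheses (noethR : noetherian R) (localR : local_ring m).
Variables (E : lmodType R) (e : {linear quotmod m -> E}).
Hypothesis hullE : injective_hull e.
Variables (C : injective_resolution R^o) (I : ideal R).
Hypothesis properI : proper_idl I.
Variables (k : nat) (y : 'I_k -> R).
Hypothesis Iy : I =i gen R^o y.
Variables (h : nat) (x : 'I_h -> R).
Hypotheses (xI : forall i, x i \in I) (regx : regular_seq x R^o).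
Hypothesis vanish : forall l, (h < l)%N ->
  forall u : local_cohomology I C l, u = 0.

Local Notation cocyc n := (@cocycle R I R^o C n).
Local Notation cobd n := (@coboundary R I R^o C n).

Let d := res_diff C.
Let H := local_cohomology I C h.
(** [T] is C itself, [K] is Gamma_I(C) and [L] is 0:_C x. [KL] and [LK] are the same subcomplex,
    built in either order to fit the lemmas on annihilators and on torsion. *)
Let T i (_ : C i) := True.
Let K := torscx T (codom y).
Let L := killcx T (codom x).
Let KL := killcx K (codom x).
Let LK := torscx L (codom y).
Let zero_idl (r : R^o) := r = 0.

Let dd i u : d i.+1 (d i u) = 0.
Proof. by apply/res_exactS; exists u. Qed.

Let cT : subcx d T. Proof. by []. Qed.
Let cK : subcx d K. Proof. exact: subcx_tors. Qed.
Let cL : subcx d L. Proof. exact: subcx_kill. Qed.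
Let cLK : subcx d LK. Proof. exact: subcx_tors. Qed.

Let xpow n := [seq z ^+ n | z <- codom x].

Let annT i : annihilates zero_idl (@T i).
Proof. by move=> r u -> _; rewrite scale0r. Qed.

Let baerT i : baer zero_idl (@T i).
Proof. exact/baer_injective/res_injective. Qed.

Let s0 : subm zero_idl. Proof. exact: subm_zero. Qed.

Let regX : regular_mod zero_idl (codom x).
Proof. exact: regular_seq_mod. Qed.

Let coT : coregcx T (codom x).
Proof. by move=> i; apply: (baer_coregular s0 _ (@annT i)). Qed.

Let coK : coregcx K (codom x).
Proof.
move=> i; have sTi : subm (@T i) by [].
apply: (baer_coregular (a := zero_idl)) => //.
- exact: subm_tors.
- by apply: annihilates_sub (@annT i) => u /torsP[].
- by apply: (baer_tors noethR) => //; exact: annT.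
Qed.

Let GammaP (M : lmodType R) (u : M) :
  u \in @Gamma R I M <-> tors (fun=> True) (codom y) u.
Proof.
rewrite torsP; split=> [/asboolP[s us]|[_ us]].
  split=> // _ /codomP[j ->]; exists s; apply: us.
  by apply: mem_ideal_pow; rewrite Iy mem_gen.
apply/asboolP.
have [|t tP] := ideal_pow_powers (u := u) (subm_zero M) Iy.
  by move=> j; apply: us; exact: codom_f.
by exists t.
Qed.

Let KP i u : @K i u <-> u \in @Gamma R I (C i).
Proof. by rewrite GammaP. Qed.

Let KLP i u : @KL i u <-> @LK i u.
Proof.
split=> [/killP[/torsP[_ tu] xu]|/torsP[/killP[_ xu] tu]].
  by apply/torsP; split=> //; apply/killP.
by apply/killP; split=> //; apply/torsP.
Qed.

Let exT i : i != 0%N -> exact_at d T i.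
Proof. by case: i => // i _ z _ /res_exactS[b ->]; exists b. Qed.

Let genT : generates d T zero_idl (res_aug C 1).
Proof.
split=> //.
- by apply/res_exact0; exists 1.
- move=> z _ /res_exact0[u ->]; exists u => /=.
  by rewrite -linearZ /= [_ *: 1]mulr1 subrr.
move=> r /= ; rewrite -linearZ /= [_ *: 1]mulr1 => r0.
by apply: (res_aug_inj (i := C)); rewrite r0 raddf0.
Qed.

(** [generates_kill] with both complexes equal to C, starting in degree 0 from the image of 1 with e
    = 1. The class c may depend on n. *)
Let generators n :
  (forall i, i != h -> exact_at d L i) /\
  exists c c' : C h,
    [/\ generates d L (addi zero_idl (codom x)) c,
        killcx T (xpow n.+1) c', d h c' = 0
      & c = (\prod_i x i) ^+ n *: c'].
Proof.
have sz : (0 + size (codom x))%N = h by rewrite add0n size_codom card_ord.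
have := @generates_kill R C d dd n (codom x) T T 0 zero_idl
  (res_aug C 1) (res_aug C 1) 1 cT cT s0 annT coT.
rewrite sz => -[||||||||exL [c [c' [gc cc' dc cE]]]] //.
- by move=> i; apply: coregular_pow.
- by apply/res_exact0; exists 1.
- by rewrite scale1r.
split=> //; exists c, c'; split=> //.
by rewrite cE mul1r big_image prodrXl.
Qed.

Let exL i : i != h -> exact_at d L i.
Proof. exact: (proj1 (generators 0)). Qed.

Let lift_boundary i v : (i < h)%N -> @L i v -> K (d i v) ->
  exists2 v', @LK i v' & d i v' = d i v.
Proof.
move=> ih Lv Kdv; apply: torsion_boundary => //.
- by move=> j; exact: res_injective.
- move=> j j' g u /killP[_ xu]; apply/killP; split=> // z /xu zu.
  by rewrite -linearZ /= zu raddf0.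
by move=> j ji; apply: exL; rewrite neq_ltn (leq_ltn_trans ji ih).
Qed.

Let lift_bd i (z : C i) : (i <= h)%N -> K z -> bd d L z -> bd d KL z.
Proof.
case: i z => [//|i] z ih Kz [v Lv zv].
have [|v' /KLP Kv' v'v] := lift_boundary ih Lv; first by rewrite -zv.
by exists v'; rewrite // v'v.
Qed.

Let exKL_below i : (i < h)%N -> exact_at d KL i.
Proof.
move=> ih z Kz dz; have /killP[Kz' _] := Kz; have /KLP/torsP[Lz _] := Kz.
apply: lift_bd => //; first exact: ltnW.
by apply: exL => //; rewrite neq_ltn ih.
Qed.

(** Boundaries of 0:_C x below degree h lift to torsion cochains, so 0:_K x is exact there; since K
    is x-torsion, so is K. *)
Let exK_below i : (i < h)%N -> exact_at d K i.
Proof.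
move=> ih; apply: (exact_unkill dd cK coK); last exact: exKL_below.
move=> _ /codomP[j ->] u /KP/asboolP[s us]; exists s; apply: us.
exact: mem_ideal_pow.
Qed.

Let mem_cocycle n (c : C n) : c \in cocyc n <-> K c /\ d n c = 0.
Proof.
rewrite KP; split=> [/andP[cG /eqP c0]|[cG c0]]; first by [].
by apply/andP; split=> //; apply/eqP.
Qed.

Let mem_coboundary n (c : submod (cocyc n)) :
  c \in cobd n <-> bd d K (val c).
Proof.
case: n c => [|n] c; first by split=> [/eqP|/eqP].
split=> [/asboolP[b bG cb]|[b /KP bG cb]]; last by apply/asboolP; exists b.
by exists b => //; apply/KP.
Qed.

Lemma local_cohomology_eq0 n :
  (forall u : local_cohomology I C n, u = 0) <-> exact_at d K n.
Proof.
split=> [H0 z Kz dz|exK u].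
  have zc : z \in cocyc n by apply/mem_cocycle.
  apply/(mem_coboundary (Sub z zc)).
  by have /eqP := H0 (quot_pr (cobd n) (Sub z zc)); rewrite quot_pr_eq0.
have [c ->] := quot_pr_surj u; apply/eqP; rewrite quot_pr_eq0.
apply/mem_coboundary; have /mem_cocycle[Kc dc] := valP c.
exact: exK.
Qed.

Let exK i : i != h -> exact_at d K i.
Proof.
rewrite neq_ltn => /orP[/exK_below //|hi].
by apply/local_cohomology_eq0; exact: vanish.
Qed.

(** The value 0 off the cocycles is a default. *)
Let cl (c : C h) : H :=
  if insub c is Some z then quot_pr (cobd h) z else 0.

Let clE c (cc : c \in cocyc h) :
  cl c = quot_pr (cobd h) (Sub c cc).
Proof. by rewrite /cl insubT. Qed.

Let classK : classifies d K cl (fun _ : H => True).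
Proof.
split=> //.
- move=> c z z' Kz dz Kz' dz'.
  have zc : z \in cocyc h by apply/mem_cocycle.
  have zc' : z' \in cocyc h by apply/mem_cocycle.
  have czc : c *: z + z' \in cocyc h by rewrite rpredD ?rpredZ.
  rewrite (clE zc) (clE zc') (clE czc) -linearP; congr (quot_pr _ _).
  by apply: val_inj; rewrite linearP.
- move=> u _; have [c ->] := quot_pr_surj u.
  have /mem_cocycle[Kc dc] := valP c; exists (val c); split=> //.
  by rewrite (clE (valP c)); congr (quot_pr _ _); apply: val_inj.
move=> z Kz dz; have zc : z \in cocyc h by apply/mem_cocycle.
rewrite (clE zc) -(mem_coboundary (Sub z zc)).
by split=> [/eqP|zb]; [|apply/eqP]; rewrite quot_pr_eq0.
Qed.

Let classKL : classifies d KL cl (kill (fun _ : H => True) (codom x)).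
Proof.
by case: (classifies_kill dd cK coK (fun i ih => exK_below ih) classK).
Qed.

Let K0 : K (0 : C h). Proof. exact: (subm0 (proj1 cK h)). Qed.

Let cl_eq0 z : K z -> d h z = 0 -> (cl z = 0 <-> bd d K z).
Proof. by case: classK => _ _ _; apply. Qed.

Let cl0 : cl 0 = 0.
Proof.
apply/cl_eq0; [exact: K0 | exact: raddf0 | exact: (subm0 (subm_bd h cK))].
Qed.

Let clZ a z : K z -> d h z = 0 -> cl (a *: z) = a *: cl z.
Proof.
move=> Kz dz; case: classK => cll _ _ _; rewrite -[a *: z]addr0 cll //.
  by rewrite cl0 addr0.
exact: raddf0.
Qed.

(** * Dual forms of (ii) and (iii) *)

Let injE : injective_module E. Proof. by case: hullE. Qed.
Let einj : injective e. Proof. by case: hullE. Qed.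

Let D := matlis_dual E H.

Lemma local_cohomology_torsion (u : H) z :
  z \in I -> exists s, z ^+ s *: u = 0.
Proof.
move=> zI; have [_ _ /(_ u Logic.I)[c [Kc dc <-]] _] := classK.
have /KP/asboolP[s cs] := Kc; exists s.
by rewrite -clZ // cs ?cl0 //; exact: mem_ideal_pow.
Qed.

(** If x_i misses some u in 0:_H (x_1, ..., x_(i-1)), a functional phi that vanishes on its image
    but not at u has x_i phi in (x_1, ..., x_(i-1)) D, while phi is not in it. Likewise, D/xD is
    nonzero exactly when 0:_H x is. *)
Lemma regular_dualP :
  regular_seq x D <-> coregular (fun _ : H => True) (codom x) /\
    exists2 u : H, u <> 0 & forall i, x i *: u = 0.
Proof.
rewrite coregularP size_codom card_ord; split=> [[xinj [q q0]]|[co [u u0 xu]]].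
  split=> [i ih u xu|].
    apply: contrapT => nv.
    pose A w := exists2 v, kill (fun _ : H => True) (take i (codom x)) v
      & w = (codom x)`_i *: v.
    have sA : subm A.
      have sk := subm_killl (take i (codom x)) (subm_full H).
      split=> [|a _ _ [v kv ->] [w kw ->]].
        by exists 0; [exact: subm0 | rewrite scaler0].
      exists (a *: v + w); first exact: (proj2 sk).
      by rewrite scalerDr !scalerA mulrC.
    have nA : ~ A u by move=> [v kv uv]; apply: nv; exists v.
    have [phi [phiA phiu]] := cogenerator injE localR einj sA nA.
    pose i' := Ordinal ih; have /= tk := take_codom x i'.
    have kE w : kill (fun _ : H => True) (take i (codom x)) w <->
        forall j, @prefix_seq _ _ x i' j *: w = 0.
      by rewrite tk kill_codom; split=> [[]|].
    have phi0 := proj1 (in_gen_Hom injE (@prefix_seq _ _ x i') phi).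
    case: phiu; apply: phi0; last exact/kE.
    rewrite -quot_pr_eq0; apply/eqP; apply: (xinj i').
    rewrite scaler0 -linearZ; apply/eqP; rewrite quot_pr_eq0.
    apply/(in_gen_Hom injE) => w xw; change (x i' *: phi w = 0).
    rewrite -linearZ; apply: phiA; exists w; first exact/kE.
    by rewrite (nth_codom 0 x i').
  apply: contrapT => nu; have [phi qphi] := quot_pr_surj q.
  move/negP: q0; apply; rewrite qphi quot_pr_eq0.
  apply/(in_gen_Hom injE) => u xu; have [->|/eqP u0] := eqVneq u 0.
    exact: raddf0.
  by case: nu; exists u.
split=> [i q q' /= qq'|].
  have [phi qphi] := quot_pr_surj (q - q').
  apply/eqP; rewrite -subr_eq0 qphi quot_pr_eq0.
  have : x i *: phi \in gen D (@prefix_seq _ _ x i).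
    have /eqP : x i *: (q - q') = 0 by rewrite scalerBr qq' subrr.
    by rewrite qphi -linearZ quot_pr_eq0.
  move=> /(in_gen_Hom injE) xphi; apply/(in_gen_Hom injE) => w xw.
  have tk := take_codom x i.
  have [|v kv <-] := co i (ltn_ord i) w; first by rewrite tk; apply/kill_codom.
  rewrite (nth_codom 0 x i) linearZ; apply: (xphi v).
  by move: kv; rewrite tk => /kill_codom[].
have [|phi [_ phiu]] := cogenerator (u := u) injE localR einj (subm_zero H).
  by [].
exists (quot_pr (gen D x) phi); rewrite quot_pr_eq0; apply/negP.
by move=> /(in_gen_Hom injE)/(_ u xu).
Qed.

(** Stage n of the direct system has exponent n + 1, as the system starts at l = 1. *)
Lemma iota_eq0 (phi : D) : iota_map (quot_pr (gen D x) phi) = 0 <->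
  exists n, (\prod_i x i) ^+ n *: phi \in gen D (pow_seq x n.+1).
Proof.
have pushE n : @push R (fun l => pow_quot x D l.+1)
    (fun l => @pow_trans R h x D l.+1) 0 (quot_pr (gen D (pow_seq x 1)) phi) n
    = quot_pr (gen D (pow_seq x n.+1)) ((\prod_i x i) ^+ n *: phi).
  elim: n => [|n IH]; first by rewrite push_id scale1r.
  by rewrite pushS // IH /= pow_trans_pr scalerA -exprS.
rewrite /iota_map dirlim_in_eq0; split=> [[n _]|[n nphi]].
  by rewrite pushE => /eqP; rewrite quot_pr_eq0; exists n.
by exists n => //; rewrite pushE; apply/eqP; rewrite quot_pr_eq0.
Qed.

(** X^l phi lies in (x^(l+1)) D exactly when phi vanishes on X^l (0:_H x^(l+1)). Functionals
    separate points from submodules, so this forces phi to vanish on 0:_H x only if that image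
    contains 0:_H x. *)
Lemma iota_injP : injective (@iota_map R h x D) <-> lifts H x.
Proof.
split=> [iinj l u xu|lif q q' qq'].
  apply: contrapT => nv.
  pose A w := exists2 v : H, forall i, x i ^+ l.+1 *: v = 0
    & w = (\prod_i x i) ^+ l *: v.
  have sA : subm A.
    split=> [|a _ _ [v kv ->] [w kw ->]].
      by exists 0 => [i|]; rewrite scaler0.
    exists (a *: v + w) => [i|]; last by rewrite scalerDr !scalerA mulrC.
    by rewrite scalerDr kw scalerA mulrC -scalerA kv scaler0 addr0.
  have nA : ~ A u by move=> [v kv uv]; apply: nv; exists v.
  have [phi [phiA phiu]] := cogenerator injE localR einj sA nA.
  case: phiu; apply: (proj1 (in_gen_Hom injE x phi)) => //.
  rewrite -quot_pr_eq0; apply/eqP/iinj; rewrite [RHS]raddf0.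
  apply/iota_eq0; exists l; apply/(in_gen_Hom injE) => w xw.
  change ((\prod_i x i) ^+ l *: phi w = 0).
  by rewrite -linearZ; apply: phiA; exists w.
have [phi qphi] := quot_pr_surj (q - q').
apply/eqP; rewrite -subr_eq0 qphi quot_pr_eq0; apply/(in_gen_Hom injE) => u xu.
have /iota_eq0[n /(in_gen_Hom injE) nphi] :
    iota_map (quot_pr (gen D x) phi) = 0.
  by rewrite -qphi /iota_map raddfB /= [X in X - _]qq' subrr.
by have [v xv <-] := lif n u xu; rewrite linearZ; apply: (nphi v).
Qed.

(** * The implications between the five conditions *)

Lemma radical_Jideal : radical I =i radical (gen R^o x) ->
  forall r : R, r \in Jideal x I.
Proof.
move=> rad r; apply/asboolP => l.
have sx := subm_mem (gen R^o (pow_seq x l)).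
have yS j : exists s, y j ^+ s *: (1 : R^o) \in gen R^o (pow_seq x l).
  have : y j \in radical I
    by apply/asboolP; exists 1%N; rewrite expr1 Iy mem_gen.
  rewrite rad => /asboolP[n yn]; exists (n * (h * l).+1)%N.
  rewrite exprM; set b := y j ^+ n in yn *.
  (* A product of h l + 1 elements of (x) lies in (x^l). *)
  have := @gen_powers R R^o _ h x sx (h * l).+1 (fun=> l) 1 (fun=> b).
  rewrite prodr_const card_ord sum_nat_const card_ord; apply => // i.
  by rewrite [_ *: _]mulr1; exact: (mem_gen (pow_seq x l)).
have [t tP] := ideal_pow_powers sx Iy yS; exists t => a /tP.
by move=> aS; have := submZ sx r aS; rewrite [a *: _]mulr1.
Qed.

Lemma ideal_pow_radical s :
  (forall a, a \in ideal_pow I s -> a \in gen R^o x) ->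
  radical I =i radical (gen R^o x).
Proof.
move=> sP r; apply/asboolP/asboolP => [[n rn]|[n /asboolP[v vn]]].
  exists (n * s)%N; rewrite exprM.
  exact: sP (mem_ideal_pow s rn).
exists n; rewrite vn; apply: (subm_sum (subm_mem I)) => i _.
by rewrite [_ *: _]mulrC; apply: (submZ (subm_mem I)).
Qed.

Lemma Jideal_radical : (forall r : R, r \in Jideal x I) ->
  radical I =i radical (gen R^o x).
Proof.
move=> /(_ 1)/asboolP/(_ 1%N)[s sP]; apply: (@ideal_pow_radical s) => a /sP.
by rewrite mul1r.
Qed.

Lemma Jideal_jmap : (forall r : R, r \in Jideal x I) ->
  forall u, exists r, @jmap R h x I r = u.
Proof.
move=> J1 u; have [r ur] := quot_pr_surj (val u).
by exists (Sub r (J1 r)); apply: val_inj.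
Qed.

Lemma jmap_lifts :
  (forall u, exists r, @jmap R h x I r = u) -> lifts H x.
Proof.
move=> jsurj l u xu.
have [_ [c [c' [gc kc' dc' cc']]]] := generators l.
case: gc => Lc dc cgen cann.
have [_ _ clS clKL0] := classKL.
have [cll' _ _ _] := classK.
have [g [Kg dg gu]] : exists g, [/\ KL g, d h g = 0 & cl g = u].
  by apply: clS; apply/kill_codom.
have /KLP/torsP[Lg tg] := Kg.
have [r gr] := cgen g Lg dg.
have /KP/asboolP[s gs] : K g by have /killP[] := Kg.
(* A power of I kills the cocycle g, so it carries r into the annihilator of the class of c, which
   is (x). *)
have rG : quot_pr (gen R^o x) (r : R^o) \in Gamma I (M := quotmod (gen R^o x)).
  apply/asboolP; exists s => a /gs ag; rewrite -linearZ; apply/eqP.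
  rewrite quot_pr_eq0; apply/addi0P/cann.
  have -> : (a *: (r : R^o)) *: c = - (a *: (g - r *: c)).
    by rewrite scalerBr ag sub0r opprK scalerA.
  have sbd := subm_bd h cL.
  by apply: (submN sbd); apply: (submZ sbd).
have [j jr] := jsurj (Sub (quot_pr (gen R^o x) (r : R^o)) rG).
have jrx : (val j : R) - r \in gen R^o x.
  rewrite -(quot_pr_eq0 (gen R^o x)) raddfB /=.
  by have /(congr1 val) /= -> := jr; rewrite subrr.
have Lx (w : C h) i : L w -> x i *: w = 0.
  by move=> /killP[_]; apply; exact: codom_f.
have jc : val j *: c = r *: c.
  apply/eqP; rewrite -subr_eq0 -scalerBl; have /asboolP[v ->] := jrx.
  rewrite scaler_suml big1 // => i _.
  by rewrite [_ *: v i]mulrC -scalerA Lx // scaler0.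
have /asboolP/(_ l.+1)[t jt] := valP j.
have x'c i : x i ^+ l.+1 *: c' = 0.
  by have /killP[_] := kc'; apply; apply: map_f; exact: codom_f.
(* Some power I^t satisfies j I^t in (x^(l+1)), which kills c'; so j c' is I-torsion. *)
have Kjc' : K (val j *: c').
  apply/KP/asboolP; exists t => a /jt /asboolP[v va].
  rewrite scalerA mulrC va scaler_suml big1 // => i _.
  by rewrite [_ *: v i]mulrC -scalerA x'c scaler0.
have djc' : d h (val j *: c') = 0 by rewrite linearZ /= dc' scaler0.
exists (cl (val j *: c')) => [i|]; rewrite -clZ //.
  by rewrite scalerA mulrC -scalerA x'c scaler0.
rewrite scalerA mulrC -scalerA -cc' jc -gu.
have Krc : K (r *: c).
  rewrite -jc cc' scalerA mulrC -scalerA; exact: (submZ (proj1 cK h)).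
have KLgr : KL (g - r *: c).
  apply/killP; split.
    by apply: (submB (proj1 cK h)) => //; have /killP[] := Kg.
  move=> z /codomP[i ->]; rewrite scalerBr scalerA mulrC -scalerA !Lx //.
  by rewrite scaler0 subrr.
have dgr : d h (g - r *: c) = 0.
  by rewrite raddfB /= dg linearZ /= dc scaler0 subr0.
have Kg' : K g by have /killP[] := Kg.
have Kgr : K (g - r *: c) by exact: (submB (proj1 cK h)).
(* The difference is a boundary in 0:_C x and I-torsion, hence the boundary of an I-torsion
   cochain. *)
have bgr : bd d KL (g - r *: c) by apply: lift_bd.
have : cl (g - r *: c) = 0 by apply/clKL0.
have drc : d h (r *: c) = 0 by rewrite linearZ /= dc scaler0.
rewrite addrC -scaleN1r cll' // scaleN1r addrC => /eqP.
by rewrite subr_eq0 => /eqP.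
Qed.

Lemma lifts_coregular :
  lifts H x -> coregular (fun _ : H => True) (codom x).
Proof. by apply: coregular_lifts => u i; apply: local_cohomology_torsion. Qed.

Lemma one_sub_unit a : a \in I -> exists b, b * (1 - a) = 1.
Proof.
move=> aI; pose J (r : R^o) := exists b, r = b * (1 - a).
have sJ : subm J.
  split=> [|c _ _ [b ->] [b' ->]]; first by exists 0; rewrite mul0r.
  by exists (c * b + b'); rewrite mulrDl -mulrA.
have sub_m := proper_sub_maximal localR.
have [[b b1]|J1] := pselect (J 1); first by exists b.
have [[/negP mprop _] _] := localR; case: mprop.
have am : a \in m by apply: (sub_m _ (subm_mem I)) => //; exact/negP.
have am' : 1 - a \in m by apply: (sub_m _ sJ J1); exists 1; rewrite mul1r.
by have := submD (subm_mem m) am' am; rewrite subrK.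
Qed.

Lemma coregular_radical : coregular (fun _ : H => True) (codom x) ->
  radical I =i radical (gen R^o x).
Proof.
move=> coH.
have exKL i : (h < i)%N -> exact_at d KL i.
  exact: (exact_kill_above dd cK coK exK classK coH).
have [_ [c [_ [gc _ _ _]]]] := generators 0; case: gc => Lc dc cgen cann.
(* Modulo torsion and boundaries, U is I c; the aim is to show that it contains c. *)
pose U (u : C h) := exists a b g,
  [/\ a \in I, bd d L b, LK g & u = a *: c + b + g].
have sbd := subm_bd h cL; have sLK := proj1 cLK h.
have sU : subm U.
  split=> [|r _ _ [a [b [g [aI bb Kg ->]]]] [a' [b' [g' [aI' bb' Kg' ->]]]]].
    exists 0, 0, 0; split; last by rewrite scale0r !addr0.
    - exact: (subm0 (subm_mem I)).
    - exact: subm0.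
    - exact: subm0.
  exists (r * a + a'), (r *: b + b'), (r *: g + g'); split.
  - exact: (proj2 (subm_mem I)).
  - exact: (proj2 sbd).
  - exact: (proj2 sLK).
  by rewrite !scalerDr scalerDl scalerA addrACA [_ *: _ + _ + _]addrACA.
have Uc : U c.
  apply: (kgenerate (ys := codom y) dd cL cLK) Lc dc => //.
  - move=> i; apply: (relex_tors noethR (a := addi zero_idl (codom x))).
    + exact: subm_addi.
    + exact: (proj1 cL).
    + exact/annihilates_kill/annT.
    + exact/baer_kill/baerT.
  (* Above degree h both 0:_C x and its torsion part are exact, hence so is the quotient. *)
  - move=> i w hi Lw /KLP dw.
    have [||g Kg dg] := exKL i.+2 _ _ dw.
    + by rewrite ltnS leqW.
    + by rewrite dd.
    have /killP[_ _] := Kg; have /KLP Kg' := Kg; have /torsP[Lg _] := Kg'.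
    have [||v Lv wv] := exL (i := i.+1) _ (submB (proj1 cL _) Lw Lg).
    + by rewrite neq_ltn ltnS hi orbT.
    + by rewrite raddfB /= dg subrr.
    by exists v => //; rewrite -wv opprB addrC subrK.
  - move=> u Ku; exists 0, 0, u; split=> //; last by rewrite scale0r !add0r.
      exact: (subm0 (subm_mem I)).
    exact: subm0.
  (* A cocycle z modulo torsion becomes a true cocycle after subtracting a torsion cochain g, so z -
     g is r c up to a boundary and y_j z lies in U. *)
  move=> _ z /codomP[j ->] Lz /KLP Kdz.
  have [||g Kg dg] := exKL h.+1 _ _ Kdz; [by [] | by rewrite dd |].
  have /KLP Kg' := Kg; have /torsP[Lg _] := Kg'.
  have [||r zgr] := cgen (z - g).
  - exact: (submB (proj1 cL h)).
  - by rewrite raddfB /= dg subrr.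
  exists (y j * r), (y j *: (z - g - r *: c)), (y j *: g); split.
  - by rewrite mulrC; apply: (submZ (subm_mem I)); rewrite Iy mem_gen.
  - exact: submZ.
  - exact: submZ.
  by rewrite -scalerA -!scalerDr [r *: c + _]addrC !subrK.
(* Nakayama's argument: (1 - a) c = b + g with 1 - a a unit. A power of I kills the torsion term, so
   it sends c to boundaries and therefore lies in (x). *)
have [a [b [g [aI bb Kg cE]]]] := Uc.
have [q qa] := one_sub_unit aI.
have cE' : c = q *: b + q *: g.
  rewrite -scalerDr -[LHS]scale1r -qa -scalerA; congr (_ *: _).
  by rewrite scalerBl scale1r {1}cE -[_ + g]addrA addrAC subrr add0r.
have /KLP/killP[/KP/asboolP[s gs] _] : LK (q *: g) by exact: submZ.
apply: (@ideal_pow_radical s) => r /gs rg.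
apply/addi0P/cann; rewrite cE' scalerDr rg addr0.
by apply: submZ => //; exact: submZ.
Qed.

(** The witness is the class of c, which is torsion because a power of I lies in (x). If it
    vanished, c would be a boundary in 0:_C x, so 1 would lie in (x), hence in I. *)
Lemma radical_socle : radical I =i radical (gen R^o x) ->
  exists2 u : H, u <> 0 & forall i, x i *: u = 0.
Proof.
move=> /radical_Jideal/(_ 1)/asboolP/(_ 1%N)[s sP].
have [_ [c [_ [[Lc dc cgen cann] _ _ _]]]] := generators 0.
have [_ _ _ clKL0] := classKL.
have xc i : x i *: c = 0 by have /killP[_] := Lc; apply; exact: codom_f.
have Kc : K c.
  apply/KP/asboolP; exists s => a /sP; rewrite mul1r => /asboolP[v ->].
  rewrite scaler_suml big1 // => i _.
  by rewrite [_ *: v i]mulrC -scalerA xc scaler0.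
exists (cl c) => [|i]; last by rewrite -clZ // xc cl0.
have KLc : KL c by apply/killP; split=> // _ /codomP[i ->].
move=> /(clKL0 _ KLc dc) bc.
have /cann/addi0P/asboolP[v v1] : bd d L (1 *: c).
  rewrite scale1r; move: c bc {xc Kc KLc Lc dc cgen cann}.
  case: (h) => // p c [w Kw ->].
  by exists w => //; have /KLP/torsP[] := Kw.
move/negP: properI; apply; rewrite v1; apply: (subm_sum (subm_mem I)) => i _.
by rewrite [_ *: _]mulrC; apply: (submZ (subm_mem I)).
Qed.

Lemma local_cohomology_ne l :
  l <> h -> forall u : local_cohomology I C l, u = 0.
Proof. by move=> /eqP lh; apply/local_cohomology_eq0; exact: exK. Qed.

(** Condition (i) is the hub: the steps (ii) to (iii), (iii) to (iv) and (iv) to (v) each first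
    derive (i), through coregularity of H. *)
Lemma equivalences :
  [<-> radical I =i radical (gen R^o x);
    regular_seq x D;
    injective (@iota_map R h x D);
    forall u, exists r, @jmap R h x I r = u;
    forall r : R, r \in Jideal x I].
Proof.
have lifts_radical lif := coregular_radical (lifts_coregular lif).
have radical_lifts rad := jmap_lifts (Jideal_jmap (radical_Jideal rad)).
tfae.
- move=> rad; apply/regular_dualP; split; last exact: radical_socle.
  exact/lifts_coregular/radical_lifts.
- move=> /regular_dualP[coH _].
  exact/iota_injP/radical_lifts/coregular_radical.
- by move=> /iota_injP lif; apply/Jideal_jmap/radical_Jideal/lifts_radical.
- by move=> jsurj; apply/radical_Jideal/lifts_radical/jmap_lifts.
- exact: Jideal_radical.
Qed.

End Main.

Theorem theorem3p7 (R : comNzRingType) (m : ideal R)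
    (noethR : noetherian R) (localR : local_ring m) (complR : adic_complete m)
    (E : lmodType R) (e : {linear quotmod m -> E}) (hullE : injective_hull e)
    (C : injective_resolution R^o)
    (I : ideal R) (properI : proper_idl I)
    (h : nat) (htI : height I h) (h_gt0 : (0 < h)%N)
    (vanish : forall l, (h < l)%N -> forall u : local_cohomology I C l, u = 0)
    (x : 'I_h -> R) (xI : forall i, x i \in I) (regx : regular_seq x R^o) :
  let D := matlis_dual E (local_cohomology I C h) in
  [/\ forall l, l <> h -> forall u : local_cohomology I C l, u = 0,
      @radical R I =i @radical R (gen R^o x) -> set_theoretic_ci I
    & [<-> (* (i) *) @radical R I =i @radical R (gen R^o x);
        (* (ii) *) regular_seq x D;
        (* (iii) *) injective (@iota_map R h x D);
        (* (iv) *) forall u, exists r, @jmap R h x I r = u;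
        (* (v) *) forall r : R, r \in Jideal x I]].
Proof.
move=> D; have [k [y Iy]] := noethR I; split.
- exact: (local_cohomology_ne noethR Iy xI regx vanish).
- by move=> rad; exists h, x.
exact: (equivalences noethR localR hullE properI Iy xI regx vanish).
Qed.
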